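(* Let $\vec a=(a_1,a_2,a_3):\mathbb{R}\to\mathbb{R}^3$ be smooth, let $D=\{(\vec\xi,\tau)\in\mathbb{R}^3\times\mathbb{R}: 1+\vec\xi\cdot\vec a(\tau)>0\}$, with coordinates $x=(\xi^1,\xi^2,\xi^3,\tau)$, $x^4=\tau$, and let $g_{\mu\nu}$ be the metric $ds^2=d\vec\xi^2-[1+\vec\xi\cdot\vec a(\tau)]^2d\tau^2$ on $D$. Let $\vec A=(A_1,A_2,A_3):\mathbb{R}\to\mathbb{R}^3$ be smooth and let $X=(X^1,X^2,X^3,X^4)$ be a smooth vector field on $D$. Then $(X,\vec A)$ satisfies the generalised Killing equation $$X^\alpha\partial_\alpha g_{\mu\nu}+g_{\alpha\nu}\,\partial_\mu X^\alpha+g_{\mu\alpha}\,\partial_\nu X^\alpha+\sum_{i=1}^3A_i(\tau)\,\frac{\partial g_{\mu\nu}}{\partial a_i}=0\qquad(\mu,\nu=1,\dots,4)$$ on $D$ if and only if there exist constants $f_0^\mu$ ($\mu=1,\dots,4$) and a constant skew-symmetric matrix $\Omega^0_{\alpha\beta}$ ($\alpha,\beta=1,\dots,4$) such that $$X^i=f^i(\tau)+\Omega^i_{\;\;j}(\tau)\,\xi^j\quad(i=1,2,3),\qquad X^4=\frac{f^4(\tau)+\Omega^4_{\;\;j}(\tau)\,\xi^j}{1+\vec\xi\cdot\vec a(\tau)},$$ where $$\Omega_{\mu\nu}(\tau)=\Omega^0_{\alpha\beta}\Lambda^\alpha_{\;\;\mu}(\tau)\Lambda^\beta_{\;\;\nu}(\tau)+\int_0^\tau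 dt\sum_{i=1}^3A_i(t)\left[G_\mu^{\;\;4}(\tau,t)G_\nu^{\;\;i}(\tau,t)-G_\mu^{\;\;i}(\tau,t)G_\nu^{\;\;4}(\tau,t)\right],$$ $$f^\mu(\tau)=f_0^\nu\Lambda_\nu^{\;\;\mu}(\tau)+\Omega^0_{\alpha\beta}\Lambda^{\alpha\mu}(\tau)\int_0^\tau dt\,\Lambda^\beta_{\;\;4}(t)+\int_0^\tau dt\int_0^tdt'\sum_{i=1}^3A_i(t')\left[G^{\mu4}(\tau,t')G_4^{\;\;i}(t,t')-G^{\mu i}(\tau,t')G_4^{\;\;4}(t,t')\right].$$
   Context: Greek indices run over $1,\dots,4$, Latin indices $i,j$ over $1,2,3$; repeated indices are summed. Except for the metric $g_{\mu\nu}$, indices are raised and lowered with $\eta_{\mu\nu}=\mathrm{diag}(1,1,1,-1)$. In the equation, $\partial g_{\mu\nu}/\partial a_i$ is the partial derivative of $g_{\mu\nu}$, regarded as a function of $(\vec\xi,a_1,a_2,a_3)$, with respect to $a_i$, evaluated at $a_j=a_j(\tau)$; thus it is zero unless $\mu=\nu=4$, and $\partial g_{44}/\partial a_i=-2(1+\vec\xi\cdot\vec a(\tau))\,\xi^i$. $W^\beta_{\;\;\alpha}(\tau)$ is the $4\times4$ matrix with $W^i_{\;\;4}=W^4_{\;\;i}=a_i(\tau)$ for $i=1,2,3$ and all other entries zero. $\Lambda^\mu_{\;\;\nu}(\tau)$ is the solution of $\frac{d}{d\tau}\Lambda^\mu_{\;\;\nu}=\Lambda^\mu_{\;\;\beta}W^\beta_{\;\;\nu}$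 with $\Lambda^\mu_{\;\;\nu}(0)=\delta^\mu_\nu$; it is a Lorentz matrix for every $\tau$. Moreover $G^\mu_{\;\;\rho}(\tau,t)=\Lambda_\nu^{\;\;\mu}(\tau)\,\Lambda^\nu_{\;\;\rho}(t)$, so that e.g. $G_\mu^{\;\;\rho}(\tau,t)=\Lambda_{\nu\mu}(\tau)\Lambda^{\nu\rho}(t)$ and $G^{\mu\rho}(\tau,t)=\Lambda_\nu^{\;\;\mu}(\tau)\Lambda^{\nu\rho}(t)$. *)

(* Defs.v *)
From Stdlib Require Import Reals.
From mathcomp Require Import all_boot.
From Coquelicot Require Import Coquelicot.

Set Implicit Arguments.
Unset Strict Implicit.
Unset Printing Implicit Defensive.

Open Scope R_scope.

Notation "\rsum_ ( i < n ) F" := (\big[Rplus/0]_(i < n) F)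
  (at level 41, F at level 41, i, n at level 50,
   format "\rsum_ ( i  <  n )  F") : R_scope.

(** Greek indices 1..4 are ['I_4] and Latin indices 1..3 are ['I_3]; the
    ordinal of value k is the index k+1. *)
Definition tm : 'I_4 := ord_max.
Definition sp (i : 'I_3) : 'I_4 := lift tm i.

(** Points of R^n are functions ['I_n -> R]; the topology on this type is Coquelicot's [fct_UniformSpace],
    which for a finite index set is the usual one (sup norm). *)

Definition upd n (x : 'I_n -> R) (i : 'I_n) (s : R) : 'I_n -> R :=
  fun j => if j == i then s else x j.

Definition partial n (i : 'I_n) (F : ('I_n -> R) -> R) (x : 'I_n -> R) : R :=
  Derive (fun s => F (upd x i s)) (x i).

Definition ex_partial n (i : 'I_n) (F : ('I_n -> R) -> R) (x : 'I_n -> R) : Prop :=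
  ex_derive (fun s => F (upd x i s)) (x i).

Definition iter_partial n (l : seq 'I_n) (F : ('I_n -> R) -> R) :
  ('I_n -> R) -> R := foldr (@partial n) F l.

(** Partial derivatives of every order exist and are continuous on [D]; meant
    for open [D].  Values of [F] outside [D] are then irrelevant. *)
Definition smooth_on n (D : ('I_n -> R) -> Prop) (F : ('I_n -> R) -> R) : Prop :=
  forall (l : seq 'I_n) (x : 'I_n -> R), D x ->
    continuous (iter_partial l F) x /\
    forall i, ex_partial i (iter_partial l F) x.

Definition smooth_curve n (c : R -> 'I_n -> R) : Prop :=
  forall (i : 'I_n) (k : nat) (t : R), ex_derive_n (fun s => c s i) k t.

Definition dot (u v : 'I_3 -> R) : R := \rsum_(i < 3) (u i * v i).

Definition space (x : 'I_4 -> R) : 'I_3 -> R := fun i => x (sp i).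
Definition time (x : 'I_4 -> R) : R := x tm.

(** [g_{mu nu}] as a function of [xi] and of the parameters [b] = (a_1, a_2, a_3). *)
Definition gpar (mu nu : 'I_4) (xi b : 'I_3 -> R) : R :=
  if mu == nu then if mu == tm then - (1 + dot xi b) ^ 2 else 1 else 0.

Section Frame.

Variable a : R -> 'I_3 -> R.

Definition dom (x : 'I_4 -> R) : Prop := 1 + dot (space x) (a (time x)) > 0.

Definition metric (mu nu : 'I_4) (x : 'I_4 -> R) : R :=
  gpar mu nu (space x) (a (time x)).

Definition dg_da (i : 'I_3) (mu nu : 'I_4) (x : 'I_4 -> R) : R :=
  partial i (gpar mu nu (space x)) (a (time x)).

Definition generalised_killing (A : R -> 'I_3 -> R)
    (X : ('I_4 -> R) -> 'I_4 -> R) : Prop :=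
  forall x, dom x -> forall mu nu : 'I_4,
    \rsum_(al < 4) (X x al * partial al (metric mu nu) x)
    + \rsum_(al < 4) (metric al nu x * partial mu (fun y => X y al) x)
    + \rsum_(al < 4) (metric mu al x * partial nu (fun y => X y al) x)
    + \rsum_(i < 3) (A (time x) i * dg_da i mu nu x) = 0.

End Frame.

Definition eta (mu nu : 'I_4) : R :=
  if mu == nu then if mu == tm then -1 else 1 else 0.

(** [shift1] and [shift2] change the position of the first, resp. second,
    index of a 2-tensor.  As eta is its own inverse, the same operation serves
    for raising and for lowering. *)
Definition shift1 (T : 'I_4 -> 'I_4 -> R) (mu nu : 'I_4) : R :=
  \rsum_(al < 4) (eta mu al * T al nu).
Definition shift2 (T : 'I_4 -> 'I_4 -> R) (mu nu : 'I_4) : R :=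
  \rsum_(al < 4) (eta nu al * T mu al).

(** [W b be al] is W^be_al, with upper index first; [unlift tm] is [Some i] on
    [sp i] and [None] on [tm]. *)
Definition W (b : 'I_3 -> R) (be al : 'I_4) : R :=
  match unlift tm be, unlift tm al with
  | Some i, None => b i
  | None, Some i => b i
  | _, _ => 0
  end.

(** [L t mu nu] is Lambda^mu_nu (t). *)
Definition is_Lambda (a : R -> 'I_3 -> R) (L : R -> 'I_4 -> 'I_4 -> R) : Prop :=
  (forall (t : R) (mu nu : 'I_4),
     is_derive (fun s => L s mu nu) t
               (\rsum_(be < 4) (L t mu be * W (a t) be nu))) /\
  (forall mu nu : 'I_4, L 0 mu nu = if mu == nu then 1 else 0).

Section Solution.

Variable L : R -> 'I_4 -> 'I_4 -> R.

(** Suffixes give the index positions, [u] for upper and [d] for lower. *)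
Definition L_ud (t : R) := L t.
Definition L_uu (t : R) := shift2 (L t).
Definition L_du (t : R) := shift1 (shift2 (L t)).

Definition G_ud (tau t : R) (mu rho : 'I_4) : R :=
  \rsum_(nu < 4) (L_du tau nu mu * L_ud t nu rho).
Definition G_du (tau t : R) := shift1 (shift2 (G_ud tau t)).
Definition G_uu (tau t : R) := shift2 (G_ud tau t).

Variables (A : R -> 'I_3 -> R) (f0 : 'I_4 -> R) (Om0 : 'I_4 -> 'I_4 -> R).

(** [Omega tau mu nu] is Omega_{mu nu}(tau), both indices lower. *)
Definition Omega (tau : R) (mu nu : 'I_4) : R :=
  \rsum_(al < 4) \rsum_(be < 4) (Om0 al be * L_ud tau al mu * L_ud tau be nu)
  + RInt (fun t => \rsum_(i < 3)
      (A t i * (G_du tau t mu tm * G_du tau t nu (sp i)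
                - G_du tau t mu (sp i) * G_du tau t nu tm))) 0 tau.

Definition Omega_ud (tau : R) := shift1 (Omega tau).

Definition f_up (mu : 'I_4) (tau : R) : R :=
  \rsum_(nu < 4) (f0 nu * L_du tau nu mu)
  + \rsum_(al < 4) \rsum_(be < 4)
      (Om0 al be * L_uu tau al mu * RInt (fun t => L_ud t be tm) 0 tau)
  + RInt (fun t => RInt (fun t' => \rsum_(i < 3)
      (A t' i * (G_uu tau t' mu tm * G_du t t' tm (sp i)
                 - G_uu tau t' mu (sp i) * G_du t t' tm tm))) 0 t) 0 tau.

End Solution.

(* Main.v *)
Require Import Defs.
From Stdlib Require Import Reals Lra FunctionalExtensionality.
From mathcomp Require Import all_boot.
From Coquelicot Require Import Coquelicot.
From mathcomp Require Import ssralg matrix.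
From mathcomp Require Import Rstruct.

(** For fixed [tau] the spatial part [d_i X^j + d_j X^i = 0] of the equation
    forces [(X(xi) - X(zeta)) . (xi - zeta) = 0] on the half-space
    [1 + xi . a > 0], by differentiating along the segment; polarization makes
    [X^i] affine in [xi] with a skew linear part.  Integrating the mixed
    equations along rays from [xi = 0] then makes [N X^4] affine, where
    [N = 1 + xi . a].  For such fields the equation is equivalent to the linear system
    [Omega' = W^T Omega + Omega W + B], [f' = - W f + eta Omega e_4], with [B]
    the bivector of the source [A].  As [Lambda' = Lambda W] and
    [K = eta Lambda^T eta] is the inverse of [Lambda], the substitution
    [Omega = Lambda^T M Lambda], [f = K p] reduces it to [M' = K^T B K] and
    [p' = eta M Lambda e_4], which is solved by two integrations. *)

Set Implicit Arguments.
Unset Strict Implicit.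
Unset Printing Implicit Defensive.

Open Scope R_scope.

(** * Calculus of finite sums and matrix-valued functions *)

(** Rigidity is applied at each [tau] separately, so the skew matrix it returns comes with no
    regularity in [tau]. The coefficients are therefore read off from [X] and its first partial
    derivatives on the line [xi = 0], which lies in the domain at every time; smoothness of [X] then
    makes them differentiable. Only first derivatives of [X] enter the rigidity argument, in place
    of the usual exchange of second derivatives, but the derivative along a slanted segment has to
    be built from coordinate derivatives, the only ones that [smooth_on] speaks of. Along a ray the
    mixed equation also produces the quadratic term [xi . O' xi], which vanishes because [O] is skew
    at every time. After the substitution neither right-hand side contains the unknown being
    integrated, so existence and uniqueness for the linear system reduce to the fundamental theorem
    of calculus. The integration constants are the values at [tau = 0], where [Lambda] is the
    identity, and the double integral in [f] arises because [M] is itself an integral. *)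

Lemma is_derive_rsum n (F : 'I_n -> R -> R) (dF : 'I_n -> R) t :
  (forall i, is_derive (F i) t (dF i)) ->
  is_derive (fun s => \rsum_(i < n) F i s) t (\rsum_(i < n) dF i).
Proof.
elim: n F dF => [|n IH] F dF h.
  rewrite big_ord0; apply: (is_derive_ext (fun=> 0)) => [s|]; first by rewrite big_ord0.
  exact: is_derive_const.
rewrite big_ord_recl.
apply: (is_derive_ext (fun s => F ord0 s + \rsum_(i < n) F (lift ord0 i) s)) => [s|].
  by rewrite big_ord_recl.
by apply: (is_derive_plus (F ord0)); [exact: h | apply: IH => i; exact: h].
Qed.

Lemma continuous_rsum (U : UniformSpace) n (F : 'I_n -> U -> R) (x : U) :
  (forall i, continuous (F i) x) ->
  continuous (fun y => \rsum_(i < n) F i y) x.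
Proof.
elim: n F => [|n IH] F h.
  apply: (continuous_ext (fun=> 0)) => [s|]; first by rewrite big_ord0.
  exact: continuous_const.
apply: (continuous_ext (fun s => F ord0 s + \rsum_(i < n) F (lift ord0 i) s)) => [s|].
  by rewrite big_ord_recl.
by apply: (continuous_plus (F ord0)); [exact: h | apply: IH => i; exact: h].
Qed.

Lemma is_RInt_rsum n (F : 'I_n -> R -> R) (I : 'I_n -> R) u v :
  (forall i, is_RInt (F i) u v (I i)) ->
  is_RInt (fun s => \rsum_(i < n) F i s) u v (\rsum_(i < n) I i).
Proof.
elim: n F I => [|n IH] F I h.
  rewrite big_ord0; apply: (is_RInt_ext (fun=> 0)) => [s _|]; first by rewrite big_ord0.
  have := is_RInt_const u v 0.
  by rewrite /scal /= /mult /= Rmult_0_r.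
rewrite big_ord_recl.
apply: (is_RInt_ext (fun s => F ord0 s + \rsum_(i < n) F (lift ord0 i) s)) => [s _|].
  by rewrite big_ord_recl.
by apply: (is_RInt_plus (F ord0)); [exact: h | apply: IH => i; exact: h].
Qed.

Definition mx_derive m n (M : R -> 'M[R]_(m, n)) (t : R) (D : 'M[R]_(m, n)) :=
  forall i j, is_derive (fun s => M s i j) t (D i j).

Definition mx_continuous m n (M : R -> 'M[R]_(m, n)) :=
  forall t i j, continuous (fun s => M s i j) t.

Definition mx_RInt m n (M : R -> 'M[R]_(m, n)) (u v : R) : 'M[R]_(m, n) :=
  \matrix_(i, j) RInt (fun t => M t i j) u v.

Lemma mx_derive_ext m n (M N : R -> 'M[R]_(m, n)) t D :
  (forall s, M s = N s) -> mx_derive M t D -> mx_derive N t D.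
Proof. by move=> e h i j; apply: is_derive_ext (h i j) => s; rewrite e. Qed.

Lemma mx_derive_continuous m n (M D : R -> 'M[R]_(m, n)) :
  (forall t, mx_derive M t (D t)) -> mx_continuous M.
Proof.
by move=> h t i j; apply: ex_derive_continuous; exists (D t i j); exact: h.
Qed.

Lemma mx_derive_const m n (C : 'M[R]_(m, n)) t : mx_derive (fun=> C) t 0%R.
Proof. by move=> i j; rewrite mxE; exact: is_derive_const. Qed.

Lemma mx_derive_add m n (M N : R -> 'M[R]_(m, n)) t D E :
  mx_derive M t D -> mx_derive N t E ->
  mx_derive (fun s => M s + N s)%R t (D + E)%R.
Proof.
move=> hM hN i j; rewrite mxE.
apply: (is_derive_ext (fun s => M s i j + N s i j)) => [s|]; first by rewrite mxE.
exact: (is_derive_plus (fun s => M s i j)).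
Qed.

Lemma mx_derive_trmx m n (M : R -> 'M[R]_(m, n)) t D :
  mx_derive M t D -> mx_derive (fun s => (M s)^T)%R t (D^T)%R.
Proof.
move=> h i j; rewrite mxE.
by apply: is_derive_ext (h j i) => s; rewrite mxE.
Qed.

Lemma mx_derive_mul m n p (M : R -> 'M[R]_(m, n)) (N : R -> 'M[R]_(n, p)) t D E :
  mx_derive M t D -> mx_derive N t E ->
  mx_derive (fun s => M s *m N s)%R t (D *m N t + M t *m E)%R.
Proof.
move=> hM hN i j; rewrite !mxE -big_split /=.
apply: (is_derive_ext (fun s => \rsum_(k < n) (M s i k * N s k j))) => [s|].
  by rewrite mxE.
apply: is_derive_rsum => k.
by apply: (is_derive_mult (fun s => M s i k)) => // ? ?; exact: Rmult_comm.
Qed.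

Lemma mx_derive_mull m n p (C : 'M[R]_(m, n)) (N : R -> 'M[R]_(n, p)) t E :
  mx_derive N t E -> mx_derive (fun s => C *m N s)%R t (C *m E)%R.
Proof.
move=> h; have := mx_derive_mul (mx_derive_const C t) h.
by rewrite mul0mx GRing.add0r.
Qed.

Lemma mx_derive_mulr m n p (M : R -> 'M[R]_(m, n)) (C : 'M[R]_(n, p)) t D :
  mx_derive M t D -> mx_derive (fun s => M s *m C)%R t (D *m C)%R.
Proof.
move=> h; have := mx_derive_mul h (mx_derive_const C t).
by rewrite mulmx0 GRing.addr0.
Qed.

Lemma mx_continuous_const m n (C : 'M[R]_(m, n)) : mx_continuous (fun=> C).
Proof. by move=> t i j; exact: continuous_const. Qed.

Lemma mx_continuous_add m n (M N : R -> 'M[R]_(m, n)) :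
  mx_continuous M -> mx_continuous N -> mx_continuous (fun s => M s + N s)%R.
Proof.
move=> hM hN t i j.
apply: (continuous_ext (fun s => M s i j + N s i j)) => [s|]; first by rewrite mxE.
exact: (continuous_plus (fun s => M s i j)).
Qed.

Lemma mx_continuous_trmx m n (M : R -> 'M[R]_(m, n)) :
  mx_continuous M -> mx_continuous (fun s => (M s)^T)%R.
Proof. by move=> h t i j; apply: continuous_ext (h t j i) => s; rewrite mxE. Qed.

Lemma mx_continuous_mul m n p (M : R -> 'M[R]_(m, n)) (N : R -> 'M[R]_(n, p)) :
  mx_continuous M -> mx_continuous N -> mx_continuous (fun s => M s *m N s)%R.
Proof.
move=> hM hN t i j.
apply: (continuous_ext (fun s => \rsum_(k < n) (M s i k * N s k j))) => [s|].
  by rewrite mxE.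
by apply: continuous_rsum => k; apply: (continuous_mult (fun s => M s i k)).
Qed.

Lemma ex_RInt_mx m n (M : R -> 'M[R]_(m, n)) u v i j :
  mx_continuous M -> ex_RInt (fun t => M t i j) u v.
Proof. by move=> h; apply: ex_RInt_continuous => z _; exact: h. Qed.

(** In the formulas the outer factors depend on the endpoint [tau] only, so they are constants for
    the integration. One-sided versions come from taking the other factor to be [1%:M]. *)
Lemma mx_RInt_sandwich m n p q (C : 'M[R]_(m, n)) (M : R -> 'M[R]_(n, p))
    (E : 'M[R]_(p, q)) u v : mx_continuous M ->
  mx_RInt (fun t => C *m M t *m E)%R u v = (C *m mx_RInt M u v *m E)%R.
Proof.
move=> h; apply/matrixP => i j; rewrite mxE; apply: is_RInt_unique.
rewrite mxE.
apply: (is_RInt_ext (fun t => \rsum_(k < p) ((C *m M t)%R i k * E k j))) => [s _|].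
  by rewrite mxE.
apply: is_RInt_rsum => k.
rewrite -[GRing.mul _ _]/(Rmult _ _) Rmult_comm.
apply: (is_RInt_ext (fun t => scal (E k j) (\rsum_(l < n) (C i l * M t l k)))) => [s _|].
  by rewrite mxE [RHS]Rmult_comm.
apply: (@is_RInt_scal R_NormedModule).
rewrite mxE; apply: is_RInt_rsum => l.
rewrite mxE.
apply: (@is_RInt_scal R_NormedModule).
by apply: RInt_correct; exact: ex_RInt_mx.
Qed.

Lemma mx_RInt_add m n (M N : R -> 'M[R]_(m, n)) u v :
  mx_continuous M -> mx_continuous N ->
  mx_RInt (fun t => M t + N t)%R u v = (mx_RInt M u v + mx_RInt N u v)%R.
Proof.
move=> hM hN; apply/matrixP => i j; rewrite !mxE.
apply: is_RInt_unique.
apply: (is_RInt_ext (fun t => M t i j + N t i j)) => [s _|]; first by rewrite mxE.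
by apply: (is_RInt_plus (fun t => M t i j)); apply: RInt_correct; exact: ex_RInt_mx.
Qed.

Lemma mx_RInt_derive m n (M : R -> 'M[R]_(m, n)) t :
  mx_continuous M -> mx_derive (mx_RInt M 0) t (M t).
Proof.
move=> h i j.
apply: (is_derive_ext (fun s => RInt (fun t => M t i j) 0 s)) => [s|]; first by rewrite mxE.
apply: (@is_derive_RInt R_NormedModule (fun t => M t i j) _ 0); last exact: h.
by apply: filter_forall => b; apply: RInt_correct; exact: ex_RInt_mx.
Qed.

Lemma mx_RInt_continuous m n (M : R -> 'M[R]_(m, n)) :
  mx_continuous M -> mx_continuous (mx_RInt M 0).
Proof. by move=> h; apply: mx_derive_continuous => t; exact: mx_RInt_derive. Qed.

Lemma mx_FTC m n (M D : R -> 'M[R]_(m, n)) t :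
  (forall s, mx_derive M s (D s)) -> mx_continuous D ->
  M t = (M 0 + mx_RInt D 0 t)%R.
Proof.
move=> hM hD; apply/matrixP => i j; rewrite !mxE.
rewrite (@is_RInt_unique R_CompleteNormedModule _ _ _ (M t i j - M 0 i j)).
  by symmetry; exact: Rplus_minus.
by apply: (@is_RInt_derive R_CompleteNormedModule (fun s => M s i j)) => s _; [exact: hM | exact: hD].
Qed.

Lemma mx_derive0_const m n (M : R -> 'M[R]_(m, n)) t :
  (forall s, mx_derive M s 0%R) -> M t = M 0.
Proof.
move=> h; rewrite (mx_FTC t h (@mx_continuous_const m n 0%R)); apply/matrixP => i j.
rewrite !mxE (@is_RInt_unique R_CompleteNormedModule _ _ _ (0 : R)) ?GRing.addr0 //.
apply: (is_RInt_ext (fun=> 0)) => [s _|]; first by rewrite ?mxE.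
have := is_RInt_const 0 t 0.
by rewrite /scal /= /mult /= Rmult_0_r.
Qed.

(** * The Lorentz frame *)

(* Matrix entries are typed in the carrier of some ring structure; [ring] needs
   them, and the operations, to be syntactically over [R]. *)
Ltac R_ring :=
  rewrite ?GRing.mulr1n ?GRing.mulr0n -?RplusE -?RmultE -?RoppE -?R0E -?R1E;
  repeat match goal with |- context [@fun_of_matrix ?T ?m ?n ?M ?i ?j] =>
    lazymatch T with
    | R => fail
    | _ => change (@fun_of_matrix T m n M i j) with (@fun_of_matrix R m n M i j)
    end end;
  match goal with |- @eq _ ?x ?y => change (@eq R x y) end; ring.

Definition eta_mx : 'M[R]_4 := \matrix_(i, j) eta i j.
Definition W_mx (b : 'I_3 -> R) : 'M[R]_4 := \matrix_(i, j) W b i j.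
Definition Lambda_mx (L : R -> 'I_4 -> 'I_4 -> R) (t : R) : 'M[R]_4 :=
  \matrix_(i, j) L t i j.
(* The inverse of [Lambda_mx L t], by the Lorentz property; locked, since
   matching up to conversion would unfold it when products are reassociated. *)
Definition Lambda_inv (L : R -> 'I_4 -> 'I_4 -> R) (t : R) : 'M[R]_4 :=
  locked (eta_mx *m (Lambda_mx L t)^T *m eta_mx)%R.
(* The source bivector: [c_k] at the entry (4, k) and [- c_k] at (k, 4). *)
Definition source_mx (c : 'I_3 -> R) : 'M[R]_4 :=
  (\sum_(k < 3) c k *: (delta_mx tm (sp k) - delta_mx (sp k) tm))%R.
Definition e4 : 'cV[R]_4 := delta_mx tm ord0.

Lemma Lambda_invE L t :
  Lambda_inv L t = (eta_mx *m (Lambda_mx L t)^T *m eta_mx)%R.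
Proof. by rewrite /Lambda_inv -lock. Qed.

Lemma eta_mxE : eta_mx = diag_mx (\row_i (if i == tm then -1 else 1)).
Proof.
apply/matrixP => i j; rewrite !mxE /eta; by case: eqP.
Qed.

Lemma eta_mxK : (eta_mx *m eta_mx = 1%:M)%R.
Proof.
rewrite {1}eta_mxE mul_diag_mx; apply/matrixP => i j; rewrite !mxE /eta.
case: (i =P j) => _; last by rewrite [LHS]Rmult_0_r.
by case: ifP => _; R_ring.
Qed.

Lemma trmx_eta : (eta_mx^T = eta_mx)%R.
Proof. by rewrite eta_mxE tr_diag_mx. Qed.

Lemma trmx_W b : ((W_mx b)^T = W_mx b)%R.
Proof.
by apply/matrixP => i j; rewrite !mxE /W; case: (unlift tm i) => [?|]; case: (unlift tm j).
Qed.

Lemma sp_neq_tm k : (sp k == tm) = false.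
Proof. by apply/negbTE; rewrite eq_sym neq_lift. Qed.

Lemma W_sp_tm b k : W b (sp k) tm = b k.
Proof. by rewrite /W /sp liftK unlift_none. Qed.

Lemma W_tm_sp b k : W b tm (sp k) = b k.
Proof. by rewrite /W /sp liftK unlift_none. Qed.

Lemma W_sp_sp b k l : W b (sp k) (sp l) = 0.
Proof. by rewrite /W /sp !liftK. Qed.

Lemma W_tm_tm b : W b tm tm = 0.
Proof. by rewrite /W unlift_none. Qed.

Lemma I4P (P : 'I_4 -> Prop) : P tm -> (forall k, P (sp k)) -> forall i, P i.
Proof. by move=> ht hs i; case: (unliftP tm i) => [j|] ->. Qed.

(** Boost generators lie in the Lorentz Lie algebra: [W_mx b] couples only time with space, and
    there the two signs in eta differ. *)
Lemma eta_W b : (eta_mx *m W_mx b = - (W_mx b *m eta_mx))%R.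
Proof.
rewrite eta_mxE mul_diag_mx mul_mx_diag; apply/matrixP => i j; rewrite !mxE.
move: i j; apply: I4P => [|k]; apply: I4P => [|l];
  rewrite ?W_sp_tm ?W_tm_sp ?W_sp_sp ?W_tm_tm ?sp_neq_tm ?eqxx;
  R_ring.
Qed.

Lemma trmx_source c : ((source_mx c)^T = - source_mx c)%R.
Proof.
rewrite /source_mx GRing.raddf_sum -GRing.sumrN; apply: eq_bigr => k _.
by rewrite /= GRing.linearZ /= GRing.linearB /= !trmx_delta -GRing.scalerN GRing.opprB.
Qed.

(** Each [delta_mx i j] is a column times a row, so [P *m delta_mx i j *m Q^T] has rank one. This
    produces the brackets under the integrals of [Omega] and [f_up]. *)
Lemma sandwich_sourceE (P Q : 'M[R]_4) c mu nu :
  (P *m source_mx c *m Q^T)%R mu nu =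
  \rsum_(k < 3) (c k * (P mu tm * Q nu (sp k) - P mu (sp k) * Q nu tm)).
Proof.
rewrite /source_mx mulmx_sumr mulmx_suml summxE; apply: eq_bigr => k _.
rewrite -scalemxAr -scalemxAl mulmxBr mulmxBl.
have h (i j : 'I_4) : (P *m delta_mx i j *m Q^T)%R mu nu = P mu i * Q nu j.
  by rewrite -(mul_delta_mx (ord0 : 'I_1)) mulmxA -mulmxA -colE -rowE mxE big_ord1 !mxE.
by rewrite !mxE -!h !mxE.
Qed.

Lemma shift1E (T : 'I_4 -> 'I_4 -> R) (M : 'M[R]_4) i j :
  (forall k l, T k l = M k l) -> shift1 T i j = (eta_mx *m M)%R i j.
Proof. by move=> h; rewrite mxE; apply: eq_bigr => k _; rewrite h mxE. Qed.

Lemma shift2E (T : 'I_4 -> 'I_4 -> R) (M : 'M[R]_4) i j :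
  (forall k l, T k l = M k l) -> shift2 T i j = (M *m eta_mx)%R i j.
Proof.
move=> h; rewrite mxE; apply: eq_bigr => k _; rewrite h -[in RHS]trmx_eta !mxE.
exact: Rmult_comm.
Qed.

Section Lambda.

Variables (a : R -> 'I_3 -> R) (L : R -> 'I_4 -> 'I_4 -> R).
Hypothesis hL : is_Lambda a L.

Let Lam := Lambda_mx L.
Let K := Lambda_inv L.
Let Wt t := W_mx (a t).

Lemma Lambda_derive t : mx_derive Lam t (Lam t *m Wt t)%R.
Proof.
move=> i j; rewrite mxE; apply: (is_derive_ext (fun s => L s i j)) => [s|].
  by rewrite mxE.
under eq_bigr do rewrite !mxE.
exact: hL.1.
Qed.

Lemma Lambda_at0 : Lam 0 = 1%:M%R.
Proof. by apply/matrixP => i j; rewrite !mxE hL.2; case: eqP. Qed.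

(** The Lorentz property: [Lam eta Lam^T] has derivative [Lam (W eta + eta W) Lam^T], which is zero
    by [eta_W], and it equals eta at time 0. *)
Lemma Lambda_mulV t : (Lam t *m K t = 1%:M)%R.
Proof.
pose N s := (Lam s *m eta_mx *m (Lam s)^T)%R.
have hN s : mx_derive N s 0%R.
  have h := mx_derive_mul (mx_derive_mulr eta_mx (@Lambda_derive s)) (mx_derive_trmx (@Lambda_derive s)).
  suff -> : 0%R = (Lam s *m Wt s *m eta_mx *m (Lam s)^T + Lam s *m eta_mx *m (Lam s *m Wt s)^T)%R by [].
  by rewrite trmx_mul trmx_W -!mulmxA -mulmxDr 2!mulmxA -mulmxDl eta_W GRing.addrN mul0mx mulmx0.
have := mx_derive0_const t hN; rewrite /N Lambda_at0 trmx1 mulmx1 mul1mx => e.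
by rewrite /K !Lambda_invE !mulmxA e eta_mxK.
Qed.

Lemma Lambda_Vmul t : (K t *m Lam t = 1%:M)%R.
Proof. exact/mulmx1C/Lambda_mulV. Qed.

Lemma trmx_Lambda_Vmul t : ((Lam t)^T *m (K t)^T = 1%:M)%R.
Proof. by have := congr1 trmx (Lambda_Vmul t); rewrite (trmx_mul (K t)) trmx1. Qed.

(** The explicit form [eta Lam^T eta] is linear in [Lam], so it is differentiated directly; moving
    [W] across eta gives the sign. *)
Lemma Lambda_inv_derive t : mx_derive K t (- (Wt t *m K t))%R.
Proof.
have h := mx_derive_mulr eta_mx (mx_derive_mull eta_mx (mx_derive_trmx (@Lambda_derive t))).
apply: (mx_derive_ext (fun s => esym (Lambda_invE L s))).
suff -> : (- (Wt t *m K t))%R = (eta_mx *m (Lam t *m Wt t)^T *m eta_mx)%R by [].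
by rewrite trmx_mul trmx_W !mulmxA eta_W !mulNmx /K !Lambda_invE ?mulmxA.
Qed.

Lemma Lambda_inv_at0 : K 0 = 1%:M%R.
Proof. by have := Lambda_Vmul 0; rewrite Lambda_at0 mulmx1. Qed.

Lemma Lambda_continuous : mx_continuous Lam.
Proof. exact: mx_derive_continuous Lambda_derive. Qed.

Lemma Lambda_inv_continuous : mx_continuous K.
Proof. exact: mx_derive_continuous Lambda_inv_derive. Qed.

Lemma eta_trLambda t : (eta_mx *m (Lam t)^T = K t *m eta_mx)%R.
Proof. by rewrite /K !Lambda_invE -!mulmxA eta_mxK mulmx1. Qed.

Lemma trmx_Lambda_inv t : ((K t)^T = eta_mx *m (Lam t *m eta_mx))%R.
Proof. by rewrite /K !Lambda_invE !trmx_mul trmxK trmx_eta mulmxA. Qed.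

Lemma L_ud_mx t i j : L_ud L t i j = Lam t i j.
Proof. by rewrite mxE. Qed.

Lemma L_uu_mx t i j : L_uu L t i j = (Lam t *m eta_mx)%R i j.
Proof. by apply: shift2E => k l; exact: L_ud_mx. Qed.

Lemma L_du_mx t i j : L_du L t i j = (eta_mx *m (Lam t *m eta_mx))%R i j.
Proof. by apply: shift1E => k l; exact: L_uu_mx. Qed.

Lemma G_ud_mx t s i j : G_ud L t s i j = (eta_mx *m (Lam t)^T *m eta_mx *m Lam s)%R i j.
Proof.
rewrite -Lambda_invE.
rewrite [RHS]mxE; apply: eq_bigr => k _.
rewrite L_du_mx L_ud_mx; congr (_ * _).
by rewrite -trmx_Lambda_inv mxE.
Qed.

(** Moving both indices of [K t *m Lam s] gives the transpose of [K s *m Lam t], the propagator in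
    the opposite direction. Hence [G_du t s] is exactly the factor by which a covariant tensor is
    carried from time [s] to time [t]. *)
Lemma G_du_mx t s i j : G_du L t s i j = ((Lam t)^T *m (K s)^T)%R i j.
Proof.
rewrite /G_du (@shift1E _ (eta_mx *m (Lam t)^T *m eta_mx *m Lam s *m eta_mx)%R) => [|k l].
  by rewrite !mulmxA eta_mxK mul1mx /K !Lambda_invE !trmx_mul trmxK trmx_eta !mulmxA.
by apply: shift2E => *; exact: G_ud_mx.
Qed.

Lemma G_uu_mx t s i j : G_uu L t s i j = (eta_mx *m (Lam t)^T *m (K s)^T)%R i j.
Proof.
rewrite /G_uu (@shift2E _ (eta_mx *m (Lam t)^T *m eta_mx *m Lam s)%R) => [|k l].
  by rewrite /K !Lambda_invE !trmx_mul trmxK trmx_eta !mulmxA.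
exact: G_ud_mx.
Qed.

(** * Matrix form of the two integral formulas and the system that they satisfy *)

Section Formula.

Variable A : R -> 'I_3 -> R.
Hypothesis A_cont : forall k t, continuous (fun s => A s k) t.

Lemma source_continuous : mx_continuous (fun t => source_mx (A t)).
Proof.
move=> t i j.
apply: (continuous_ext (fun s => \rsum_(k < 3) (A s k * ((delta_mx tm (sp k) - delta_mx (sp k) tm : 'M[R]_4) i j)%R))).
  by move=> s; rewrite summxE; apply: eq_bigr => k _; rewrite [in RHS]mxE.
apply: continuous_rsum => k.
by apply: (continuous_mult (fun s => A s k)); [exact: A_cont | exact: continuous_const].
Qed.

(* The source bivector carried back to time 0. *)
Let S t := ((K t)^T *m source_mx (A t) *m K t)%R.

Lemma transported_source_continuous : mx_continuous S.
Proof.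
apply: mx_continuous_mul; last exact: Lambda_inv_continuous.
by apply: mx_continuous_mul; [exact/mx_continuous_trmx/Lambda_inv_continuous | exact: source_continuous].
Qed.

Variables (f0 : 'I_4 -> R) (Om0 : 'I_4 -> 'I_4 -> R).

Let Om0_mx : 'M[R]_4 := (\matrix_(i, j) Om0 i j)%R.
Let M t := (Om0_mx + mx_RInt S 0 t)%R.

Lemma transported_integral_continuous : mx_continuous M.
Proof.
apply: mx_continuous_add; first exact: mx_continuous_const.
exact/mx_RInt_continuous/transported_source_continuous.
Qed.

Lemma Omega_mx t mu nu :
  Omega L A Om0 t mu nu = ((Lam t)^T *m M t *m Lam t)%R mu nu.
Proof.
rewrite /M mulmxDr mulmxDl mxE; congr (_ + _).
  under eq_bigr do under eq_bigr do rewrite !L_ud_mx.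
  rewrite exchange_big mxE; apply: eq_bigr => be _.
  rewrite [X in _ = GRing.mul X _]mxE GRing.mulr_suml; apply: eq_bigr => al _ /=.
  by rewrite !mxE; R_ring.
rewrite -mx_RInt_sandwich; last exact: transported_source_continuous.
rewrite mxE; apply: RInt_ext => s _.
(* Regrouped as [P *m source *m P^T] with [P = G_du t s], so that [sandwich_sourceE] applies. *)
have -> : ((Lam t)^T *m S s *m Lam t = (Lam t)^T *m (K s)^T *m source_mx (A s) *m ((Lam t)^T *m (K s)^T)^T)%R.
  by rewrite [in RHS](trmx_mul (Lam _)^T) !trmxK /S !mulmxA.
rewrite sandwich_sourceE.
by apply: eq_bigr => k _; rewrite !G_du_mx.
Qed.

(** Splitting [M] into its constant part [Om0_mx] and its integral part turns the single integral on
    the right into the second and third terms of the formula for [f]. *)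
Lemma f_up_mx t mu :
  f_up L A f0 Om0 mu t =
  (K t *m (\col_i f0 i + mx_RInt (fun s => eta_mx *m (M s *m Lam s *m e4)) 0 t))%R mu ord0.
Proof.
rewrite mulmxDr mxE /f_up Rplus_assoc; congr (_ + _).
  rewrite mxE; apply: eq_bigr => nu _; rewrite L_du_mx.
  by rewrite -trmx_Lambda_inv !mxE Rmult_comm.
(* The eta under the integral comes out, and [K t *m eta_mx] becomes [eta_mx *m (Lam t)^T], the form
   in which [L_uu] and [G_uu] occur. *)
transitivity ((eta_mx *m (Lam t)^T *m mx_RInt (fun s => M s *m Lam s *m e4) 0 t)%R mu ord0); last first.
  rewrite eta_trLambda -mulmxA; congr (fun_of_matrix (_ *m _)%R _ _).
  have := mx_RInt_sandwich eta_mx 1%:M%R 0 t (M := fun s => (M s *m Lam s *m e4)%R).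
  rewrite mulmx1 => <-; first by apply/matrixP => i j; rewrite !mxE; apply: RInt_ext => s _; rewrite mulmx1.
  apply: mx_continuous_mul; last exact: mx_continuous_const.
  by apply: mx_continuous_mul; [exact: transported_integral_continuous | exact: Lambda_continuous].
have cLe : mx_continuous (fun s => Lam s *m e4)%R.
  by apply: mx_continuous_mul; [exact: Lambda_continuous | exact: mx_continuous_const].
have -> : mx_RInt (fun s => M s *m Lam s *m e4)%R 0 t =
  (mx_RInt (fun s => Om0_mx *m (Lam s *m e4)) 0 t + mx_RInt (fun s => mx_RInt S 0 s *m (Lam s *m e4)) 0 t)%R.
  rewrite -mx_RInt_add; first by apply/matrixP => i j; rewrite !mxE; apply: RInt_ext => s _;
    rewrite /M -mulmxA mulmxDl.
  - by apply: mx_continuous_mul cLe; exact: mx_continuous_const.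
  - by apply: mx_continuous_mul cLe; exact/mx_RInt_continuous/transported_source_continuous.
rewrite mulmxDr mxE; congr (_ + _).
  have -> : mx_RInt (fun s => Om0_mx *m (Lam s *m e4))%R 0 t = (Om0_mx *m mx_RInt (fun s => Lam s *m e4)%R 0 t)%R.
    rewrite -[RHS]mulmx1 -mx_RInt_sandwich //.
    by apply/matrixP => i j; rewrite !mxE; apply: RInt_ext => s _; rewrite mulmx1.
  rewrite mulmxA exchange_big mxE; apply: eq_bigr => be _.
  rewrite [X in _ = GRing.mul X _]mxE GRing.mulr_suml; apply: eq_bigr => al _ /=.
  have -> : RInt (fun s => L_ud L s be tm) 0 t = mx_RInt (fun s => Lam s *m e4)%R 0 t be ord0.
    by rewrite mxE; apply: RInt_ext => s _; rewrite -colE [RHS]mxE L_ud_mx.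
  have -> : (eta_mx *m (Lam t)^T = (Lam t *m eta_mx)^T)%R by rewrite trmx_mul trmx_eta.
  by rewrite L_uu_mx [in RHS]mxE [X in _ = (_ * X * _)%R]mxE; R_ring.
have cM2 : mx_continuous (fun s => mx_RInt S 0 s *m (Lam s *m e4))%R.
  by apply: mx_continuous_mul cLe; exact/mx_RInt_continuous/transported_source_continuous.
(* The factor at time [t] goes under the outer integral, and then both outer factors go under the
   inner one. Multiplication by [e4] selects column 4, the fixed lower index of [G_du] in the
   formula. *)
rewrite -[X in _ = fun_of_matrix X _ _]mulmx1 -mx_RInt_sandwich // mxE; apply: RInt_ext => s _.
rewrite mulmx1 !mulmxA -colE [RHS]mxE -mx_RInt_sandwich; last exact: transported_source_continuous.
rewrite mxE; apply: RInt_ext => r _.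
have -> : (eta_mx *m (Lam t)^T *m S r *m Lam s =
    eta_mx *m (Lam t)^T *m (K r)^T *m source_mx (A r) *m ((Lam s)^T *m (K r)^T)^T)%R.
  by rewrite [in RHS](trmx_mul (Lam _)^T) !trmxK /S !mulmxA.
rewrite sandwich_sourceE; apply: eq_bigr => k _.
by rewrite !G_du_mx !G_uu_mx.
Qed.


Lemma transported_integral_derive t : mx_derive M t (S t).
Proof.
rewrite -[S t]GRing.add0r; apply: mx_derive_add; first exact: mx_derive_const.
by apply: mx_RInt_derive; exact: transported_source_continuous.
Qed.

Lemma Lambda_source t : ((Lam t)^T *m S t *m Lam t = source_mx (A t))%R.
Proof.
by rewrite /S -!mulmxA Lambda_Vmul mulmx1 !mulmxA trmx_Lambda_Vmul mul1mx.
Qed.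

Let Omt t : 'M[R]_4 := (\matrix_(i, j) Omega L A Om0 t i j)%R.
Let ft t : 'cV[R]_4 := (\col_i f_up L A f0 Om0 i t)%R.

Lemma OmtE t : Omt t = ((Lam t)^T *m M t *m Lam t)%R.
Proof. by apply/matrixP => i j; rewrite mxE Omega_mx. Qed.

(** [S] is a congruence transform of the skew source matrix. Integration and the congruence by
    [Lam t] both preserve skewness. *)
Lemma Omega_skew t : (Om0_mx^T = - Om0_mx)%R -> ((Omt t)^T = - Omt t)%R.
Proof.
move=> h; rewrite !OmtE trmx_mul (trmx_mul (Lam t)^T) trmxK mulmxA -mulNmx -mulmxN.
congr (_ *m _ *m _)%R; rewrite /M GRing.linearD /= h GRing.opprD; congr (_ + _)%R.
apply/matrixP => i j; rewrite !mxE.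
have -> : RInt (fun s => S s j i) 0 t = RInt (fun s => opp (S s i j)) 0 t.
  apply: RInt_ext => s _; rewrite -[LHS]/(S s j i).
  have -> : S s j i = ((S s)^T)%R i j by rewrite [RHS]mxE.
  rewrite /S trmx_mul (trmx_mul (K s)^T) trmxK trmx_source mulmxA mulmxN mulNmx.
  by rewrite [LHS]mxE.
rewrite (@RInt_opp R_CompleteNormedModule) //.
by apply: ex_RInt_mx; exact: transported_source_continuous.
Qed.

Lemma Omega_derive t :
  mx_derive Omt t (Wt t *m Omt t + Omt t *m Wt t + source_mx (A t))%R.
Proof.
apply: (mx_derive_ext (fun s => esym (OmtE s))).
have h := mx_derive_mul (mx_derive_mul (mx_derive_trmx (@Lambda_derive t))
  (@transported_integral_derive t)) (@Lambda_derive t).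
congr (mx_derive _ _ _): h.
rewrite !OmtE trmx_mul trmx_W mulmxDl Lambda_source -!mulmxA.
by rewrite -GRing.addrA [(source_mx _ + _)%R]GRing.addrC GRing.addrA.
Qed.

Lemma f_derive t :
  mx_derive ft t (- (Wt t *m ft t) + eta_mx *m (Omt t *m e4))%R.
Proof.
pose p t := (\col_i f0 i + mx_RInt (fun s => eta_mx *m (M s *m Lam s *m e4)) 0 t)%R.
have ftE s : ft s = (K s *m p s)%R.
  by apply/matrixP => i j; rewrite mxE f_up_mx ord1.
have hp : mx_derive p t (eta_mx *m (M t *m Lam t *m e4))%R.
  rewrite -[X in mx_derive _ _ X]GRing.add0r; apply: mx_derive_add; first exact: mx_derive_const.
  apply: (@mx_RInt_derive _ _ (fun s => eta_mx *m (M s *m Lam s *m e4))%R).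
  apply: mx_continuous_mul; first exact: mx_continuous_const.
  apply: mx_continuous_mul; last exact: mx_continuous_const.
  by apply: mx_continuous_mul; [exact: transported_integral_continuous | exact: Lambda_continuous].
apply: (mx_derive_ext (fun s => esym (ftE s))).
have h := mx_derive_mul (@Lambda_inv_derive t) hp.
congr (mx_derive _ _ _): h.
by rewrite ftE OmtE !mulmxA eta_trLambda mulNmx -!mulmxA.
Qed.

End Formula.

(** Uniqueness for the linear system: in the moving frame the derivatives of [Mt] and then of [p]
    are known functions, so any solution is recovered by integration from its values at 0. *)
Lemma ode_solution (A : R -> 'I_3 -> R) (Om : R -> 'M[R]_4) (f : R -> 'cV[R]_4) :
  (forall k t, continuous (fun s => A s k) t) ->
  (forall t, mx_derive Om t (Wt t *m Om t + Om t *m Wt t + source_mx (A t))%R) ->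
  (forall t, mx_derive f t (- (Wt t *m f t) + eta_mx *m (Om t *m e4))%R) ->
  forall t, (forall i j, Omega L A (Om 0) t i j = Om t i j) /\
    (forall i, f_up L A (f 0 ^~ ord0) (Om 0) i t = f t i ord0).
Proof.
move=> hA hOm hf.
pose Mt t := ((K t)^T *m Om t *m K t)%R.
have LM t : ((Lam t)^T *m Mt t *m Lam t = Om t)%R.
  by rewrite /Mt -!mulmxA Lambda_Vmul mulmx1 !mulmxA trmx_Lambda_Vmul mul1mx.
have dM t : mx_derive Mt t ((K t)^T *m source_mx (A t) *m K t)%R.
  have h := mx_derive_mul (mx_derive_mul (mx_derive_trmx (@Lambda_inv_derive t)) (hOm t))
    (@Lambda_inv_derive t).
  congr (mx_derive _ _ _): h.
  rewrite GRing.linearN /= (trmx_mul (W_mx _)) trmx_W !mulmxDr !mulmxDl mulNmx mulmxN.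
  rewrite !mulNmx !mulmxA.
  by rewrite -!GRing.addrA GRing.addKr GRing.addrCA GRing.addrN GRing.addr0.
have MtE t : Mt t = (\matrix_(i, j) Om 0 i j + mx_RInt (fun s => (K s)^T *m source_mx (A s) *m K s) 0 t)%R.
  rewrite (mx_FTC t dM) /Mt ?Lambda_inv_at0 ?trmx1 ?mul1mx ?mulmx1; last exact: transported_source_continuous.
  by congr (_ + _)%R; apply/matrixP => i j; rewrite mxE.
clearbody Mt; pose p t := (Lam t *m f t)%R.
have dp t : mx_derive p t (eta_mx *m (Mt t *m Lam t *m e4))%R.
  have h := mx_derive_mul (@Lambda_derive t) (hf t).
  congr (mx_derive _ _ _): h.
  (* The two terms containing [W] cancel, and [Lam eta Lam^T = eta] removes the frame standing in
     front of [Mt]. *)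
  rewrite mulmxDr mulmxN !mulmxA GRing.addNKr -LM !mulmxA.
  by rewrite -[(Lam t *m eta_mx *m _)%R]mulmxA eta_trLambda mulmxA Lambda_mulV mul1mx.
have pE t : p t = (\col_i f 0 i ord0 + mx_RInt (fun s => eta_mx *m (Mt s *m Lam s *m e4)) 0 t)%R.
  rewrite (mx_FTC t dp) /p ?Lambda_at0 ?mul1mx.
    by congr (_ + _)%R; apply/matrixP => i j; rewrite mxE ord1.
  apply: mx_continuous_mul; first exact: mx_continuous_const.
  apply: mx_continuous_mul; last exact: mx_continuous_const.
  by apply: mx_continuous_mul; [exact: mx_derive_continuous dM | exact: Lambda_continuous].
move=> t; split=> [i j|i].
  by rewrite Omega_mx // -MtE LM.
rewrite f_up_mx //.
have -> : f t = (K t *m p t)%R by rewrite /p mulmxA Lambda_Vmul mul1mx.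
rewrite pE; congr (fun_of_matrix (_ *m (_ + _))%R _ _).
by apply/matrixP => k l; rewrite !mxE; apply: RInt_ext => s _; rewrite MtE.
Qed.

End Lambda.

(** * The linear system for the coefficients *)

Lemma rsum_I4 (F : 'I_4 -> R) :
  \rsum_(al < 4) F al = \rsum_(k < 3) F (sp k) + F tm.
Proof.
rewrite big_ord_recr; congr (_ + _); apply: eq_bigr => k _; congr F.
by apply: val_inj; rewrite /= /bump leqNgt ltn_ord.
Qed.

Lemma is_derive_val (g f : R -> R) t l l' :
  (forall s, f s = g s) -> is_derive f t l -> l = l' -> is_derive g t l'.
Proof. by move=> e h <-; exact: is_derive_ext h. Qed.

Lemma dotC u v : dot u v = dot v u.
Proof. by apply: eq_bigr => i _; exact: Rmult_comm. Qed.

Lemma dotNl u v : dot (fun i => - u i) v = - dot u v.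
Proof.
rewrite -[RHS]Rmult_1_r -Ropp_mult_distr_l Ropp_mult_distr_r /dot big_distrl.
by apply: eq_bigr => i _ /=; ring.
Qed.

(* [y] and [U] are the coefficients of [N X^4], where [N = 1 + xi . a]. *)
Definition affine_field (a : R -> 'I_3 -> R) (X : ('I_4 -> R) -> 'I_4 -> R)
    (F : R -> 'I_3 -> R) (y : R -> R) (O : R -> 'I_3 -> 'I_3 -> R)
    (U : R -> 'I_3 -> R) : Prop :=
  forall x, dom a x ->
    (forall i, X x (sp i) = F (time x) i + \rsum_(j < 3) (O (time x) i j * x (sp j))) /\
    X x tm = (y (time x) + \rsum_(j < 3) (U (time x) j * x (sp j)))
             / (1 + dot (space x) (a (time x))).

(** The components of the matrix system for [f = (F, y)] and a skew [Omega] with spatial block [O].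
    Since lowering the index 4 changes the sign, [U i] is at once [Omega^4_i] and [Omega_{i4}]. *)
Definition killing_ode (a A : R -> 'I_3 -> R)
    (F : R -> 'I_3 -> R) (y : R -> R) (O : R -> 'I_3 -> 'I_3 -> R)
    (U : R -> 'I_3 -> R) : Prop :=
  forall t, [/\ (forall i j, O t i j = - O t j i),
    (forall i, is_derive (fun s => F s i) t (U t i - a t i * y t)),
    is_derive y t (- dot (F t) (a t)),
    (forall i j, is_derive (fun s => O s i j) t (U t i * a t j - a t i * U t j)) &
    (forall i, is_derive (fun s => U s i) t (dot (O t i) (a t) - A t i))].

(** * Space and time blocks of the matrices in the system *)

Lemma source_mx_sp_sp c i j : source_mx c (sp i) (sp j) = 0.
Proof.
rewrite summxE big1 // => k _; rewrite !mxE !sp_neq_tm andbF.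
by R_ring.
Qed.

Lemma source_mx_sp_tm c i : source_mx c (sp i) tm = - c i.
Proof.
rewrite summxE (bigD1 i) //= big1 => [|k ki]; rewrite !mxE !sp_neq_tm ?eqxx /=; first by R_ring.
by rewrite (inj_eq lift_inj) eq_sym (negbTE ki); R_ring.
Qed.

Lemma source_mx_tm_sp c i : source_mx c tm (sp i) = c i.
Proof.
have := congr1 (fun M : 'M[R]_4 => M (sp i) tm) (trmx_source c).
by rewrite !mxE source_mx_sp_tm => ->; R_ring.
Qed.

Lemma source_mx_tm_tm c : source_mx c tm tm = 0.
Proof.
rewrite summxE big1 // => k _; rewrite !mxE [tm == sp k]eq_sym !sp_neq_tm andbF.
by R_ring.
Qed.

Lemma W_mxl (b : 'I_3 -> R) m (M : 'M[R]_(4, m)) j :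
  (forall i, (W_mx b *m M)%R (sp i) j = b i * M tm j) /\
  (W_mx b *m M)%R tm j = dot b (fun k => M (sp k) j).
Proof.
split=> [i|]; rewrite mxE [LHS]rsum_I4 ![W_mx b _ tm]mxE.
  rewrite big1 => [|k _]; rewrite ?[W_mx b _ _]mxE ?W_sp_sp ?W_sp_tm; R_ring.
rewrite W_tm_tm -[RHS]Rplus_0_r; congr (_ + _); last by R_ring.
by apply: eq_bigr => k _; rewrite [W_mx b _ _]mxE W_tm_sp.
Qed.

Lemma W_mxr (b : 'I_3 -> R) m (M : 'M[R]_(m, 4)) j :
  (forall i, (M *m W_mx b)%R j (sp i) = b i * M j tm) /\
  (M *m W_mx b)%R j tm = dot (fun k => M j (sp k)) b.
Proof.
have [h1 h2] := W_mxl b (M^T)%R j.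
have e i : (M *m W_mx b)%R j i = (W_mx b *m M^T)%R i j.
  by rewrite -{2}[W_mx b]trmx_W -trmx_mul [RHS]mxE.
split=> [i|]; rewrite e ?h1 ?h2 ?mxE //.
by apply: eq_bigr => k _; rewrite mxE Rmult_comm.
Qed.

Lemma eta_e4 (M : 'M[R]_4) :
  (forall i, (eta_mx *m (M *m e4))%R (sp i) ord0 = M (sp i) tm) /\
  (eta_mx *m (M *m e4))%R tm ord0 = - M tm tm.
Proof.
rewrite -colE eta_mxE mul_diag_mx.
by split=> [i|]; rewrite !mxE ?sp_neq_tm ?eqxx; R_ring.
Qed.

Lemma shift1_sp (T : 'I_4 -> 'I_4 -> R) i nu : shift1 T (sp i) nu = T (sp i) nu.
Proof.
rewrite /shift1 (bigD1 (sp i)) //= /eta eqxx sp_neq_tm big1 => [|k ki]; first by ring.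
by rewrite eq_sym (negbTE ki); ring.
Qed.

Lemma shift1_tm (T : 'I_4 -> 'I_4 -> R) nu : shift1 T tm nu = - T tm nu.
Proof.
rewrite /shift1 (bigD1 tm) //= /eta !eqxx big1 => [|k ki]; first by ring.
by rewrite eq_sym (negbTE ki); ring.
Qed.

Section Ode.

Variables (a A : R -> 'I_3 -> R) (L : R -> 'I_4 -> 'I_4 -> R).
Hypothesis hL : is_Lambda a L.
Hypothesis A_cont : forall k t, continuous (fun s => A s k) t.

Lemma formula_ode f0 Om0 : (forall al be, Om0 al be = - Om0 be al) ->
  killing_ode a A (fun t i => f_up L A f0 Om0 (sp i) t) (f_up L A f0 Om0 tm)
    (fun t i j => Omega_ud L A Om0 t (sp i) (sp j)) (fun t i => Omega_ud L A Om0 t tm (sp i)).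
Proof.
move=> sk t.
pose Omt t : 'M[R]_4 := (\matrix_(i, j) Omega L A Om0 t i j)%R.
have skt s i j : Omega L A Om0 s i j = - Omega L A Om0 s j i.
  have /(Omega_skew hL A_cont s) : ((\matrix_(i, j) Om0 i j)^T = - (\matrix_(i, j) Om0 i j) :> 'M[R]_4)%R.
    by apply/matrixP => k l; rewrite !mxE.
  by move/matrixP/(_ j i); rewrite !mxE => ->.
have dOm := Omega_derive hL A_cont Om0 t.
have df := f_derive hL A_cont f0 Om0 t.
have dOmE i j D : (W_mx (a t) *m Omt t + Omt t *m W_mx (a t) + source_mx (A t))%R i j = D ->
    is_derive (fun s => Omega L A Om0 s i j) t D.
  by move=> <-; apply: is_derive_ext (dOm i j) => s; rewrite mxE.
have dfE i D : (- (W_mx (a t) *m (\col_i f_up L A f0 Om0 i t)) + eta_mx *m (Omt t *m e4))%R i ord0 = D ->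
    is_derive (f_up L A f0 Om0 i) t D.
  by move=> <-; apply: is_derive_ext (df i ord0) => s; rewrite mxE.
have U_E s i : Omega_ud L A Om0 s tm (sp i) = Omega L A Om0 s (sp i) tm.
  by rewrite /Omega_ud shift1_tm [RHS]skt.
split=> [i j|i||i j|i]; rewrite ?U_E.
- by rewrite /Omega_ud !shift1_sp.
- apply: dfE; rewrite mxE (eta_e4 _).1 [X in GRing.add X _]mxE (W_mxl _ _ _).1 !mxE.
  by R_ring.
- apply: dfE; rewrite mxE (eta_e4 _).2 [X in GRing.add X _]mxE (W_mxl _ _ _).2 !mxE.
  have -> : Omega L A Om0 t tm tm = 0 by have := skt t tm tm; lra.
  rewrite -!RplusE -!RoppE Ropp_0 Rplus_0_r; congr (- _).
  by apply: eq_bigr => k _; rewrite mxE Rmult_comm.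
- apply: (is_derive_ext (fun s => Omega L A Om0 s (sp i) (sp j))) => [s|].
    by rewrite /Omega_ud shift1_sp.
  apply: dOmE; rewrite mxE source_mx_sp_sp [X in GRing.add X _]mxE (W_mxl _ _ _).1 (W_mxr _ _ _).1 !mxE.
  by rewrite (skt t tm); R_ring.
- apply: (is_derive_ext (fun s => Omega L A Om0 s (sp i) tm)) => [s|]; first by rewrite U_E.
  apply: dOmE; rewrite mxE source_mx_sp_tm [X in GRing.add X _]mxE (W_mxl _ _ _).1 (W_mxr _ _ _).2 !mxE.
  have -> : Omega L A Om0 t tm tm = 0 by have := skt t tm tm; lra.
  have -> : dot (fun k => (Omt t) (sp i) (sp k)) (a t) = dot (fun j => Omega_ud L A Om0 t (sp i) (sp j)) (a t).
    by apply: eq_bigr => k _; rewrite mxE /= /Omega_ud shift1_sp.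
  by R_ring.
Qed.

Lemma ode_formula F y O U : killing_ode a A F y O U ->
  exists f0 Om0, (forall al be : 'I_4, Om0 al be = - Om0 be al) /\
  forall t, [/\ (forall i, f_up L A f0 Om0 (sp i) t = F t i),
   f_up L A f0 Om0 tm t = y t,
   (forall i j, Omega_ud L A Om0 t (sp i) (sp j) = O t i j) &
   (forall i, Omega_ud L A Om0 t tm (sp i) = U t i)].
Proof.
move=> h.
pose f t : 'cV[R]_4 := (\col_mu (if unlift tm mu is Some i then F t i else y t))%R.
(* Both indices are lower here, so [U] enters with a plus sign at (i, 4) and skewness fixes the
   remaining entries. *)
pose Om t : 'M[R]_4 := (\matrix_(mu, nu)
  match unlift tm mu, unlift tm nu with
  | Some i, Some j => O t i j
  | Some i, None => U t i
  | None, Some j => - U t j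
  | None, None => 0
  end)%R.
have Oss t i j : Om t (sp i) (sp j) = O t i j by rewrite mxE /sp !liftK.
have Ost t i : Om t (sp i) tm = U t i by rewrite mxE /sp !liftK unlift_none.
have Ots t i : Om t tm (sp i) = - U t i by rewrite mxE /sp !liftK unlift_none.
have Ott t : Om t tm tm = 0 by rewrite mxE !unlift_none.
have fs t i : f t (sp i) ord0 = F t i by rewrite mxE /sp !liftK.
have ft t : f t tm ord0 = y t by rewrite mxE !unlift_none.
have skt t i j : Om t i j = - Om t j i.
  by move: i j; apply: I4P => [|i]; apply: I4P => [|j];
   rewrite ?Oss ?Ost ?Ots ?Ott; try lra; case: (h t).
have dOm t : mx_derive Om t (W_mx (a t) *m Om t + Om t *m W_mx (a t) + source_mx (A t))%R.
  have [sk _ _ dO dU] := h t.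
  apply: I4P => [|i]; apply: I4P => [|j]; rewrite mxE [X in GRing.add X _]mxE
   ?(W_mxl _ _ _).1 ?(W_mxr _ _ _).1 ?(W_mxl _ _ _).2 ?(W_mxr _ _ _).2
   ?source_mx_tm_sp ?source_mx_sp_tm ?source_mx_sp_sp ?source_mx_tm_tm.
  - apply: (@is_derive_val _ (fun=> 0) t 0); [by move=> s; rewrite Ott | exact: is_derive_const |].
    rewrite dotC (_ : dot (fun k => Om t tm (sp k)) _ = dot (fun k => - Om t (sp k) tm) (a t)); last by apply: eq_bigr => k _; rewrite Ots Ost.
    by rewrite dotNl; R_ring.
  - apply: (@is_derive_val _ (fun s => - U s j) t (- (dot (O t j) (a t) - A t j))).
    + by move=> s; rewrite Ots.
    + exact: (is_derive_opp (fun s => U s j)).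
    rewrite Ott (_ : dot (a t) _ = dot (fun k => - O t j k) (a t)); last by rewrite dotC; apply: eq_bigr => k _; rewrite Oss -sk.
    by rewrite dotNl; R_ring.
  - apply: (@is_derive_val _ (fun s => U s i) t _ _ _ (dU i)); first by move=> s; rewrite Ost.
    rewrite Ott (_ : dot (fun k => Om t (sp i) (sp k)) _ = dot (O t i) (a t)); first by R_ring.
    by apply: eq_bigr => k _; rewrite Oss.
  - apply: (@is_derive_val _ (fun s => O s i j) t _ _ _ (dO i j)); first by move=> s; rewrite Oss.
    by rewrite Ots Ost; R_ring.
have df t : mx_derive f t (- (W_mx (a t) *m f t) + eta_mx *m (Om t *m e4))%R.
  have [_ dF dy _ _] := h t.
  move=> i j; rewrite ord1; move: i {j}; apply: I4P => [|i]; rewrite mxE [X in GRing.add X _]mxE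
   ?(W_mxl _ _ _).1 ?(W_mxl _ _ _).2 ?(eta_e4 _).1 ?(eta_e4 _).2.
  - apply: (@is_derive_val _ y t _ _ _ dy); first by move=> s; rewrite ft.
    rewrite Ott (_ : dot (a t) _ = dot (F t) (a t)); first by R_ring.
    by rewrite dotC; apply: eq_bigr => k _; rewrite fs.
  - apply: (@is_derive_val _ (fun s => F s i) t _ _ _ (dF i)); first by move=> s; rewrite fs.
    by rewrite ft Ost; R_ring.
exists (fun mu => f 0 mu ord0), (fun mu nu => Om 0 mu nu); split; first exact: skt.
move=> t; have [hO hf] := ode_solution hL A_cont dOm df t.
split=> [i||i j|i]; rewrite ?hf // /Omega_ud ?shift1_sp ?shift1_tm hO //.
by rewrite Ots Ropp_involutive.
Qed.

End Ode.

(** * Components of the generalised Killing equation *)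

Lemma updE n (x : 'I_n -> R) i : upd x i (x i) = x.
Proof. by apply: functional_extensionality => j; rewrite /upd; case: eqP => // ->. Qed.

Lemma time_upd_tm x s : time (upd x tm s) = s.
Proof. by rewrite /time /upd eqxx. Qed.

Lemma space_upd_tm x s : space (upd x tm s) = space x.
Proof. by apply: functional_extensionality => j; rewrite /space /upd sp_neq_tm. Qed.

Lemma time_upd_sp x i s : time (upd x (sp i) s) = time x.
Proof. by rewrite /time /upd eq_sym sp_neq_tm. Qed.

Lemma space_upd_sp x i s : space (upd x (sp i) s) = upd (space x) i s.
Proof.
by apply: functional_extensionality => j; rewrite /space /upd (inj_eq lift_inj).
Qed.

Lemma dot_updl (u v : 'I_3 -> R) i s :
  dot (upd u i s) v = dot u v + (s - u i) * v i.
Proof.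
rewrite /dot (bigD1 i) //= [X in _ = X + _](bigD1 i) //= /upd eqxx.
rewrite (eq_bigr (fun j => u j * v j)) => [|j /negbTE ->] //; ring.
Qed.

Lemma is_derive_rsum_coef n (c dF : 'I_n -> R) (G : 'I_n -> R -> R) t :
  (forall i, is_derive (G i) t (dF i)) ->
  is_derive (fun s => \rsum_(i < n) (c i * G i s)) t (\rsum_(i < n) (c i * dF i)).
Proof.
move=> h; apply: is_derive_rsum => i.
exact: (is_derive_scal (G i)).
Qed.

Definition lapse (a : R -> 'I_3 -> R) (x : 'I_4 -> R) : R :=
  1 + dot (space x) (a (time x)).

Definition velocity (a : R -> 'I_3 -> R) (t : R) (i : 'I_3) : R :=
  Derive (fun s => a s i) t.

Lemma lapse_upd_sp a x i s :
  lapse a (upd x (sp i) s) = lapse a x + (s - x (sp i)) * a (time x) i.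
Proof. by rewrite /lapse space_upd_sp time_upd_sp dot_updl; rewrite /space; ring. Qed.

Lemma lapse_upd_tm a x s : lapse a (upd x tm s) = 1 + dot (space x) (a s).
Proof. by rewrite /lapse space_upd_tm time_upd_tm. Qed.

Lemma curve_derive n (c : R -> 'I_n -> R) t i :
  smooth_curve c -> is_derive (fun s => c s i) t (Derive (fun s => c s i) t).
Proof. by move=> h; apply: Derive_correct; exact: (h i 1%N t). Qed.

Section Killing.

Variables (a A : R -> 'I_3 -> R).
Hypothesis ha : smooth_curve a.

Lemma lapse_derive_sp x i :
  is_derive (fun s => lapse a (upd x (sp i) s)) (x (sp i)) (a (time x) i).
Proof.
apply: (is_derive_ext (fun s => lapse a x + (s - x (sp i)) * a (time x) i)).
  by move=> s; rewrite lapse_upd_sp.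
by auto_derive => //; ring.
Qed.

Lemma lapse_derive_tm x :
  is_derive (fun s => lapse a (upd x tm s)) (time x) (dot (space x) (velocity a (time x))).
Proof.
apply: (is_derive_ext (fun s => 1 + dot (space x) (a s))) => [s|].
  by rewrite lapse_upd_tm.
rewrite -[X in is_derive _ _ X]Rplus_0_l.
apply: (is_derive_plus (fun=> 1)); first exact: is_derive_const.
apply: is_derive_rsum_coef => i.
exact: curve_derive.
Qed.

Lemma metric_tm_tm x : metric a tm tm x = - lapse a x ^ 2.
Proof. by rewrite /metric /gpar !eqxx. Qed.

Lemma metric_sp_sp i x : metric a (sp i) (sp i) x = 1.
Proof. by rewrite /metric /gpar eqxx sp_neq_tm. Qed.

Lemma metric_diag (mu : 'I_4) (P : 'I_4 -> R) x :
  \rsum_(al < 4) (metric a al mu x * P al) = metric a mu mu x * P mu.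
Proof.
rewrite (bigD1 mu) //= big1 ?Rplus_0_r // => k kmu.
by rewrite /metric /gpar (negbTE kmu); ring.
Qed.

Lemma metric_diagC (mu : 'I_4) (P : 'I_4 -> R) x :
  \rsum_(al < 4) (metric a mu al x * P al) = metric a mu mu x * P mu.
Proof.
rewrite -metric_diag; apply: eq_bigr => k _.
by rewrite /metric /gpar eq_sym; case: eqP => // ->.
Qed.

Lemma partial_metric_0 al mu nu x : ~~ ((mu == tm) && (nu == tm)) ->
  partial al (metric a mu nu) x = 0.
Proof.
move=> h; rewrite /partial /metric.
rewrite (Derive_ext _ (fun=> if mu == nu then 1 else 0)) ?Derive_const // => s.
rewrite /gpar; case: eqP => // e; move: h; rewrite -e andbb.
by case: eqP.
Qed.

Lemma derive_metric_tm al x d :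
  is_derive (fun s => lapse a (upd x al s)) (x al) d ->
  partial al (metric a tm tm) x = - 2 * lapse a x * d.
Proof.
move=> h; apply: is_derive_unique.
apply: (is_derive_ext (fun s => - lapse a (upd x al s) ^ 2)) => [s|]; first by rewrite metric_tm_tm.
have -> : - 2 * lapse a x * d = opp (plus (mult d (lapse a x)) (mult (lapse a x) d)).
  by rewrite /opp /plus /mult /=; ring.
apply: (is_derive_opp (fun s => lapse a (upd x al s) ^ 2)).
apply: (is_derive_ext (fun s => mult (lapse a (upd x al s)) (lapse a (upd x al s)))).
  by move=> s; rewrite /mult /=; ring.
have -> : lapse a x = lapse a (upd x al (x al)) by rewrite updE.
by apply: (is_derive_mult (fun s => lapse a (upd x al s))) => // ? ?; exact: Rmult_comm.
Qed.

Lemma dg_da_tm i x : dg_da a i tm tm x = - 2 * lapse a x * space x i.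
Proof.
apply: is_derive_unique.
apply: (is_derive_ext (fun s => - (lapse a x + (s - a (time x) i) * space x i) ^ 2)) => [s|].
  by rewrite /gpar !eqxx dotC dot_updl dotC Rplus_assoc.
by auto_derive => //; ring.
Qed.

Lemma dg_da_0 i mu nu x : ~~ ((mu == tm) && (nu == tm)) -> dg_da a i mu nu x = 0.
Proof.
move=> h; rewrite /dg_da /partial.
rewrite (Derive_ext _ (fun=> if mu == nu then 1 else 0)) ?Derive_const // => s.
rewrite /gpar; case: eqP => // e; move: h; rewrite -e andbb.
by case: eqP.
Qed.

(** Only [g_44] varies, so the first and last sums of the equation survive only for [mu = nu = 4].
    That component carries the factor [-2 N], which is nonzero on the domain and has been
    cancelled. *)
Lemma killing_split X : generalised_killing a A X <->
  forall x, dom a x ->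
  [/\ (forall i j, partial (sp i) (fun y => X y (sp j)) x
                 + partial (sp j) (fun y => X y (sp i)) x = 0),
      (forall i, partial tm (fun y => X y (sp i)) x
               = lapse a x ^ 2 * partial (sp i) (fun y => X y tm) x) &
      dot (fun i => X x (sp i)) (a (time x))
      + X x tm * dot (space x) (velocity a (time x))
      + lapse a x * partial tm (fun y => X y tm) x + dot (A (time x)) (space x) = 0].
Proof.
have z mu nu x : ~~ ((mu == tm) && (nu == tm)) ->
    \rsum_(al < 4) (X x al * partial al (metric a mu nu) x) = 0.
  by move=> h; rewrite big1 // => k _; rewrite partial_metric_0 //; ring.
have z' mu nu x : ~~ ((mu == tm) && (nu == tm)) ->
    \rsum_(i < 3) (A (time x) i * dg_da a i mu nu x) = 0.
  by move=> h; rewrite big1 // => k _; rewrite dg_da_0 //; ring.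
have sc c (u v w : 'I_3 -> R) : (forall i, w i = c * v i) -> \rsum_(i < 3) (u i * w i) = c * dot u v.
  by move=> h; rewrite /dot big_distrr; apply: eq_bigr => i _; rewrite h /=; ring.
(* By the chain rule for [- N^2], every derivative of [g_44] is [-2 N] times one of [N]: [a_i] along
   [xi^i], [xi . a'] along [tau], and [xi^i] along the parameter [a_i]. *)
have e x : \rsum_(al < 4) (X x al * partial al (metric a tm tm) x)
    + \rsum_(i < 3) (A (time x) i * dg_da a i tm tm x)
    = - 2 * lapse a x * (dot (fun i => X x (sp i)) (a (time x))
      + X x tm * dot (space x) (velocity a (time x)) + dot (A (time x)) (space x)).
  rewrite rsum_I4 (sc (- 2 * lapse a x) _ (a (time x))) => [|i]; last first.
    by rewrite (derive_metric_tm (lapse_derive_sp x i)).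
  rewrite (derive_metric_tm (lapse_derive_tm x)) (sc (- 2 * lapse a x) _ (space x)) => [|i].
    ring.
  by rewrite dg_da_tm.
split=> h x dx; last first.
  have [h1 h2 h3] := h x dx.
  apply: I4P => [|i]; apply: I4P => [|j]; rewrite metric_diag metric_diagC.
  - rewrite metric_tm_tm; have := e x; move: h3; nra.
  - rewrite z ?sp_neq_tm ?andbF // z' ?sp_neq_tm ?andbF // metric_tm_tm metric_sp_sp h2; ring.
  - rewrite z ?sp_neq_tm ?andbF // z' ?sp_neq_tm ?andbF // metric_tm_tm metric_sp_sp h2; ring.
  - rewrite z ?sp_neq_tm ?andbF // z' ?sp_neq_tm ?andbF // !metric_sp_sp; have := h1 i j; lra.
have k mu nu := h x dx mu nu.
split=> [i j|i|].
- by have := k (sp i) (sp j); rewrite metric_diag metric_diagC z ?sp_neq_tm ?andbF // z' ?sp_neq_tm ?andbF // !metric_sp_sp; lra.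
- by have := k (sp i) tm; rewrite metric_diag metric_diagC z ?sp_neq_tm ?andbF // z' ?sp_neq_tm ?andbF // metric_sp_sp metric_tm_tm; lra.
have := k tm tm; rewrite metric_diag metric_diagC metric_tm_tm; have := e x.
move: dx; rewrite /dom -/(lapse a x) => N0 e1 e2.
by apply: (Rmult_eq_reg_l (- 2 * lapse a x)); nra.
Qed.

End Killing.

(** * Affine fields *)

Definition event (xi : 'I_3 -> R) (t : R) : 'I_4 -> R :=
  fun mu => if unlift tm mu is Some i then xi i else t.

Lemma event_sp xi t i : event xi t (sp i) = xi i.
Proof. by rewrite /event /sp liftK. Qed.

Lemma event_tm xi t : event xi t tm = t.
Proof. by rewrite /event unlift_none. Qed.

Lemma space_event xi t : space (event xi t) = xi.
Proof. by apply: functional_extensionality => i; exact: event_sp. Qed.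

Lemma time_event xi t : time (event xi t) = t.
Proof. exact: event_tm. Qed.

Lemma eventE x : event (space x) (time x) = x.
Proof.
by apply: functional_extensionality; apply: I4P => [|i]; rewrite ?event_tm ?event_sp.
Qed.

Definition axis (j : 'I_3) (h : R) : 'I_3 -> R := upd (fun=> 0) j h.

Lemma dot0l v : dot (fun=> 0) v = 0.
Proof. by rewrite /dot big1 // => i _; ring. Qed.

Lemma dot_axisl j h v : dot (axis j h) v = h * v j.
Proof. by rewrite dot_updl dot0l; ring. Qed.

Lemma dot_axisr j h v : dot v (axis j h) = h * v j.
Proof. by rewrite dotC dot_axisl. Qed.

Lemma dotDl u v w : dot (fun i => u i + v i) w = dot u w + dot v w.
Proof. by rewrite /dot -big_split; apply: eq_bigr => i _ /=; ring. Qed.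

Lemma dotZl c u v : dot (fun i => c * u i) v = c * dot u v.
Proof. by rewrite /dot big_distrr; apply: eq_bigr => i _ /=; ring. Qed.

Lemma rsum_abs_ge n (v : 'I_n -> R) j : Rabs (v j) <= \rsum_(i < n) Rabs (v i).
Proof.
rewrite (bigD1 j) //=; set r := (X in _ <= _ + X).
have : 0 <= r.
  by apply: (big_ind (fun r => 0 <= r)) => [|? ?|i _]; [lra | lra | exact: Rabs_pos].
lra.
Qed.

Lemma axis_step (b : 'I_3 -> R) : exists2 h, 0 < h & forall j, 1 + dot (axis j h) b > 0.
Proof.
(* [m] is positive and bounds every [Rabs (b j)]; the step [/ (2 * m)] then changes [1 + xi . b] by
   at most one half on each axis. *)
pose m := 1 + \rsum_(j < 3) Rabs (b j).
have m0 : 0 < m by rewrite /m; have := Rabs_pos (b ord0); have := rsum_abs_ge b ord0; lra.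
have hm j : Rabs (b j) <= m by rewrite /m; have := rsum_abs_ge b j; lra.
exists (/ (2 * m)) => [|j]; first by apply: Rinv_0_lt_compat; lra.
rewrite dot_axisl.
have -> : 1 + / (2 * m) * b j = (2 * m + b j) * / (2 * m) by field; lra.
apply: Rmult_gt_0_compat; last by apply: Rinv_0_lt_compat; lra.
by have := hm j; split_Rabs; lra.
Qed.

(** The half-space contains the origin, which gives [c], and a short segment of each axis, which
    gives [d j]. *)
Lemma affine_eq0 (b : 'I_3 -> R) c (d : 'I_3 -> R) :
  (forall xi, 1 + dot xi b > 0 -> c + dot d xi = 0) -> c = 0 /\ forall j, d j = 0.
Proof.
move=> h.
have c0 : c = 0.
  by have := h (fun=> 0); rewrite dot0l dotC dot0l; lra.
split=> // j; have [e e0 /(_ j)/h] := axis_step b.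
rewrite dot_axisr c0 Rplus_0_l => /Rmult_integral; lra.
Qed.

Section Affine.

Variables (a A : R -> 'I_3 -> R).
Hypothesis ha : smooth_curve a.

Lemma lapse_line x al : exists d, is_derive (fun s => lapse a (upd x al s)) (x al) d.
Proof.
move: al; apply: I4P => [|i]; eexists; first exact: lapse_derive_tm.
exact: lapse_derive_sp.
Qed.

(** The affine formulas hold on the domain only; this lets them be differentiated at a point of
    it. *)
Lemma dom_line x al : dom a x -> locally (x al) (fun s => dom a (upd x al s)).
Proof.
move=> dx; have [d hd] := lapse_line x al.
have c : continuous (fun s => lapse a (upd x al s)) (x al).
  by apply: ex_derive_continuous; exists d.
apply: c; rewrite updE; exact: open_gt dx.
Qed.

Variables (X : ('I_4 -> R) -> 'I_4 -> R).
Variables (F : R -> 'I_3 -> R) (y : R -> R) (O : R -> 'I_3 -> 'I_3 -> R) (U : R -> 'I_3 -> R).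
Variables (F' : R -> 'I_3 -> R) (y' : R -> R) (O' : R -> 'I_3 -> 'I_3 -> R) (U' : R -> 'I_3 -> R).
Hypothesis dF : forall t i, is_derive (fun s => F s i) t (F' t i).
Hypothesis dy : forall t, is_derive y t (y' t).
Hypothesis dO : forall t i j, is_derive (fun s => O s i j) t (O' t i j).
Hypothesis dU : forall t i, is_derive (fun s => U s i) t (U' t i).
Hypothesis affine_sp : forall x i, dom a x ->
  X x (sp i) = F (time x) i + dot (O (time x) i) (space x).
Hypothesis affine_tm : forall x, dom a x ->
  X x tm = (y (time x) + dot (U (time x)) (space x)) / lapse a x.

Lemma is_derive_dot_upd c (u : 'I_3 -> R) (v : 'I_3 -> R) k :
  is_derive (fun s => c + dot u (upd v k s)) (v k) (u k).
Proof.
apply: (is_derive_ext (fun s => c + (dot u v + (s - v k) * u k))) => [s|].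
  by rewrite [dot u (upd _ _ _)]dotC dot_updl dotC.
by auto_derive => //; ring.
Qed.

Lemma is_derive_dotl (u u' : R -> 'I_3 -> R) v t : (forall i, is_derive (fun s => u s i) t (u' t i)) ->
  is_derive (fun s => dot (u s) v) t (dot (u' t) v).
Proof.
move=> h; rewrite dotC; apply: (is_derive_ext (fun s => dot v (u s))) => [s|]; first exact: dotC.
exact: is_derive_rsum_coef.
Qed.

Lemma partial_loc al (G H : ('I_4 -> R) -> R) x d : dom a x ->
  (forall z, dom a z -> G z = H z) ->
  is_derive (fun s => H (upd x al s)) (x al) d -> partial al G x = d.
Proof.
move=> dx e h; apply: is_derive_unique; apply: is_derive_ext_loc h.
by apply: filter_imp (dom_line al dx) => s ds; rewrite e.
Qed.

Lemma partial_affine_sp_sp x i k : dom a x ->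
  partial (sp k) (fun z => X z (sp i)) x = O (time x) i k.
Proof.
move=> dx; apply: (partial_loc dx (fun z => @affine_sp z i)).
apply: (is_derive_ext (fun s => F (time x) i + dot (O (time x) i) (upd (space x) k s))) => [s|].
  by rewrite time_upd_sp space_upd_sp.
exact: is_derive_dot_upd.
Qed.

Lemma partial_affine_tm_sp x i : dom a x ->
  partial tm (fun z => X z (sp i)) x = F' (time x) i + dot (O' (time x) i) (space x).
Proof.
move=> dx; apply: (partial_loc dx (fun z => @affine_sp z i)).
apply: (is_derive_ext (fun s => F s i + dot (O s i) (space x))) => [s|].
  by rewrite time_upd_tm space_upd_tm.
apply: (is_derive_plus (fun s => F s i)); first exact: dF.
by apply: (@is_derive_dotl (fun s => O s i) (fun s => O' s i)) => j; exact: dO.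
Qed.

(** The product rule for [N X^4], whose value is the affine numerator; [d] and [d'] are the
    derivatives of the numerator and of the lapse. *)
Lemma partial_affine_tm al x d : dom a x ->
  is_derive (fun s => y (time (upd x al s)) + dot (U (time (upd x al s))) (space (upd x al s))) (x al) d ->
  forall d', is_derive (fun s => lapse a (upd x al s)) (x al) d' ->
  lapse a x * partial al (fun z => X z tm) x = d - X x tm * d'.
Proof.
move=> dx h d' h'; have N0 : lapse a x <> 0 by move: dx; rewrite /dom -/(lapse a x); lra.
have hd := is_derive_div _ _ _ _ _ h h'; rewrite updE in hd.
by rewrite (partial_loc dx affine_tm (hd N0)) affine_tm //; field.
Qed.

Lemma partial_affine_sp_tm x k : dom a x ->
  lapse a x * partial (sp k) (fun z => X z tm) x = U (time x) k - X x tm * a (time x) k.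
Proof.
move=> dx; apply: partial_affine_tm => //; last exact: lapse_derive_sp.
apply: (is_derive_ext (fun s => y (time x) + dot (U (time x)) (upd (space x) k s))) => [s|].
  by rewrite time_upd_sp space_upd_sp.
exact: is_derive_dot_upd.
Qed.

Lemma partial_affine_tm_tm x : dom a x ->
  lapse a x * partial tm (fun z => X z tm) x =
  y' (time x) + dot (U' (time x)) (space x) - X x tm * dot (space x) (velocity a (time x)).
Proof.
move=> dx; apply: partial_affine_tm => //; last exact: lapse_derive_tm.
apply: (is_derive_ext (fun s => y s + dot (U s) (space x))) => [s|].
  by rewrite time_upd_tm space_upd_tm.
apply: (is_derive_plus y); first exact: dy.
by apply: is_derive_dotl => j; exact: dU.
Qed.

(** In the (4,4) equation the term with the velocity of [a] cancels against the derivative of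
    [1 / N] in [X^4]. In the mixed equations [N^2 d_i X^4] equals [N (U_i - X^4 a_i)], and [N X^4]
    is the affine numerator. *)
Lemma affine_killing : generalised_killing a A X <->
  forall x, dom a x -> let t := time x in let xi := space x in
  [/\ (forall i j, O t i j = - O t j i),
      (forall i, F' t i + dot (O' t i) xi = U t i * lapse a x - a t i * (y t + dot (U t) xi)) &
      y' t + dot (U' t) xi + dot (F t) (a t) + dot (fun i => dot (O t i) xi) (a t) + dot (A t) xi = 0].
Proof.
rewrite killing_split //; split=> h x dx; have [h1 h2 h3] := h x dx.
all: have N0 : lapse a x > 0 by exact: dx.
all: have eY : y (time x) + dot (U (time x)) (space x) = X x tm * lapse a x by rewrite affine_tm //; field; lra.
all: have e3 : dot (fun i => X x (sp i)) (a (time x)) = dot (F (time x)) (a (time x)) + dot (fun i => dot (O (time x) i) (space x)) (a (time x)) by rewrite -dotDl; apply: eq_bigr => i _; rewrite affine_sp.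
all: have e4 := partial_affine_tm_tm dx.
all: have e2 i := partial_affine_sp_tm i dx.
- split=> [i j|i|].
  + by have := h1 i j; rewrite !partial_affine_sp_sp //; lra.
  + have := h2 i; rewrite partial_affine_tm_sp // => ->.
    by rewrite eY -Rmult_assoc; have := e2 i; move: (partial _ _ _) => p e; 
      transitivity (lapse a x * (lapse a x * p)); [ring | rewrite e; ring].
  + by move: h3; rewrite e3 e4; lra.
- split=> [i j|i|].
  + by rewrite !partial_affine_sp_sp // (h1 i j); ring.
  + rewrite partial_affine_tm_sp // h2 eY.
    by have := e2 i; move: (partial _ _ _) => p e; 
      transitivity (lapse a x * (lapse a x * p)); [rewrite e; ring | ring].
  + by rewrite e3 e4; lra.
Qed.

End Affine.

(** * The equation for affine fields is equivalent to the linear system *)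

Lemma dot_skew (O : 'I_3 -> 'I_3 -> R) u v : (forall i j, O i j = - O j i) ->
  dot (fun i => dot (O i) u) v = - dot (fun i => dot (O i) v) u.
Proof.
move=> h; rewrite -dotNl /dot.
under eq_bigr do rewrite big_distrl.
rewrite exchange_big; apply: eq_bigr => j _ /=.
rewrite -Ropp_mult_distr_l Ropp_mult_distr_r big_distrl.
by apply: eq_bigr => i _ /=; rewrite h; ring.
Qed.

Lemma killing_of_ode a A X F y O U : smooth_curve a ->
  affine_field a X F y O U -> killing_ode a A F y O U -> generalised_killing a A X.
Proof.
move=> ha hX h.
have dF t i : is_derive (fun s => F s i) t (U t i - a t i * y t) by case: (h t).
have dy t : is_derive y t (- dot (F t) (a t)) by case: (h t).
have dO t i j : is_derive (fun s => O s i j) t (U t i * a t j - a t i * U t j) by case: (h t).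
have dU t i : is_derive (fun s => U s i) t (dot (O t i) (a t) - A t i) by case: (h t).
apply/(affine_killing A ha dF dy dO dU (fun x i dx => (hX x dx).1 i) (fun x dx => (hX x dx).2)) => x dx t xi; have [sk _ _ _ _] := h t.
split=> // [i|].
- rewrite (_ : dot _ xi = U t i * dot (a t) xi + - a t i * dot (U t) xi); last first.
    by rewrite -!dotZl -dotDl; apply: eq_bigr => j _; ring.
  rewrite /lapse -/xi -/t [dot xi _]dotC; ring.
- rewrite (dot_skew xi (a t) sk) (_ : dot _ xi = dot (fun i => dot (O t i) (a t)) xi + - dot (A t) xi); last first.
    by rewrite -dotNl -dotDl; apply: eq_bigr => j _; ring.
  ring.
Qed.

(** At a fixed time each condition of [affine_killing] is affine in [xi], so its coefficients can be
    compared by [affine_eq0]. The differentiability hypotheses ensure that the total function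
    [Derive] returns true derivatives. *)
Lemma ode_of_killing a A X F y O U : smooth_curve a ->
  affine_field a X F y O U ->
  (forall i t, ex_derive (fun s => F s i) t) -> (forall t, ex_derive y t) ->
  (forall i j t, ex_derive (fun s => O s i j) t) -> (forall i t, ex_derive (fun s => U s i) t) ->
  generalised_killing a A X -> killing_ode a A F y O U.
Proof.
move=> ha hX eF ey eO eU.
have dF t i := Derive_correct _ _ (eF i t).
have dy t := Derive_correct _ _ (ey t).
have dO t i j := Derive_correct _ _ (eO i j t).
have dU t i := Derive_correct _ _ (eU i t).
move/(affine_killing A ha (F' := fun t i => Derive (fun s => F s i) t)
  (y' := fun t => Derive y t) (O' := fun t i j => Derive (fun s => O s i j) t)
  (U' := fun t i => Derive (fun s => U s i) t) dF dy dO dU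
  (fun x i dx => (hX x dx).1 i) (fun x dx => (hX x dx).2)) => h t.
have h' xi : 1 + dot xi (a t) > 0 -> dom a (event xi t).
  by rewrite /dom space_event time_event.
have sk : forall i j, O t i j = - O t j i.
  have /h' /h [] : 1 + dot (fun=> 0) (a t) > 0 by rewrite dot0l; lra.
  by rewrite time_event.
have h2 i : Derive (fun s => F s i) t - U t i + a t i * y t = 0 /\
    forall j, Derive (fun s => O s i j) t - U t i * a t j + a t i * U t j = 0.
  apply: (@affine_eq0 (a t)) => xi /h' /h [_ /(_ i) + _].
  rewrite /lapse !time_event !space_event.
  rewrite (_ : dot (fun j => _ + _) xi =
    dot (fun j => Derive (fun s => O s i j) t) xi + (- U t i * dot (a t) xi + a t i * dot (U t) xi)).
    by rewrite [dot xi _]dotC; lra.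
  by rewrite -!dotZl -!dotDl; apply: eq_bigr => j _; ring.
have [h3 h4] : Derive y t + dot (F t) (a t) = 0 /\
    forall j, Derive (fun s => U s j) t - dot (O t j) (a t) + A t j = 0.
  apply: (@affine_eq0 (a t)) => xi /h' /h [_ _].
  rewrite /lapse !time_event !space_event (dot_skew xi (a t) sk).
  rewrite (_ : dot (fun j => _ + _) xi =
    dot (fun j => Derive (fun s => U s j) t) xi + (- dot (fun i => dot (O t i) (a t)) xi + dot (A t) xi)).
    by lra.
  by rewrite -!dotNl -!dotDl; apply: eq_bigr => j _; ring.
split=> // [i||i j|i].
- have [e _] := h2 i; suff <- : Derive (fun s => F s i) t = U t i - a t i * y t by exact: dF.
  by lra.
- suff <- : Derive y t = - dot (F t) (a t) by exact: dy.
  by lra.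
- have [_ /(_ j) e] := h2 i.
  suff <- : Derive (fun s => O s i j) t = U t i * a t j - a t i * U t j by exact: dO.
  by lra.
- have e := h4 i; suff <- : Derive (fun s => U s i) t = dot (O t i) (a t) - A t i by exact: dU.
  by lra.
Qed.

(** * Rigidity along lines *)

Lemma upd_same n (x : 'I_n -> R) i s : upd x i s i = s.
Proof. by rewrite /upd eqxx. Qed.

Lemma upd_upd n (x : 'I_n -> R) i r s : upd (upd x i r) i s = upd x i s.
Proof. by apply: functional_extensionality => j; rewrite /upd; case: (j == i). Qed.

(** Mean value theorem in one coordinate: the increment is the step times a partial derivative at an
    intermediate point. *)
Lemma partial_increment n (F : ('I_n -> R) -> R) (i : 'I_n) w r0 r1 p e :
  (forall r, Rmin r0 r1 <= r <= Rmax r0 r1 ->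
     ex_partial i F (upd w i r) /\ Rabs (partial i F (upd w i r) - p) <= e) ->
  Rabs (F (upd w i r1) - F (upd w i r0) - p * (r1 - r0)) <= e * Rabs (r1 - r0).
Proof.
move=> h.
have d r : Rmin r0 r1 <= r <= Rmax r0 r1 ->
    is_derive (fun s => F (upd w i s)) r (partial i F (upd w i r)).
  case/h => -[l hl] _; rewrite /partial upd_same.
  apply: (is_derive_ext (fun s => F (upd (upd w i r) i s))) => [s|]; first by rewrite upd_upd.
  by rewrite upd_same in hl; apply: Derive_correct; exists l.
have [r lr|r lr|c [lc ->]] := @MVT_gen (fun s => F (upd w i s)) r0 r1 (fun r => partial i F (upd w i r)).
- by apply: d; lra.
- by apply/continuity_pt_filterlim/(ex_derive_continuous (V := R_NormedModule)); eexists; exact: d.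
rewrite -Rmult_minus_distr_r Rabs_mult; apply: Rmult_le_compat_r; first exact: Rabs_pos.
by case: (h c lc).
Qed.

(** Coordinates are moved one at a time: [z k s] has the first [k] of them displaced, the increment
    of [F] telescopes over [k], and continuity of the partial derivatives lets each step be compared
    with the derivative at [x]. *)
Lemma chain_rule_line n (F : ('I_n -> R) -> R) (x v : 'I_n -> R) :
  (forall i, locally x (ex_partial i F)) ->
  (forall i, continuous (partial i F) x) ->
  is_derive (fun s => F (fun j => x j + s * v j)) 0 (\rsum_(i < n) (v i * partial i F x)).
Proof.
move=> hex hc.
pose z k s : 'I_n -> R := fun j => x j + (if (j < k)%N then s * v j else 0).
have z_succ s (i : 'I_n) : z i.+1 s = upd (z i s) i (x i + s * v i).
  apply: functional_extensionality => j; rewrite /upd /z ltnS leq_eqVlt -val_eqE /=.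
  by case: (j =P i :> nat) => [/val_inj ->|].
have z_upd s (i : 'I_n) : z i s = upd (z i s) i (x i).
  rewrite -[LHS](updE _ i); congr upd.
  by rewrite /z ltnn Rplus_0_r.
have step (i : 'I_n) : is_derive (fun s => F (z i.+1 s) - F (z i s)) 0 (v i * partial i F x).
  (* A bound on all [Rabs (v j)]; the summand 1 keeps it positive when [v] is zero. *)
  pose m := 1 + \rsum_(j < n) Rabs (v j).
  have hm j : Rabs (v j) <= m by rewrite /m; have := rsum_abs_ge v j; lra.
  have m0 : 0 < m by rewrite /m; have := Rabs_pos (v i); have := rsum_abs_ge v i; lra.
  apply/is_derive_Reals => eps eps0.
  (* After multiplication by [Rabs (v i) <= m] the error is at most [eps / 2], which makes the final
     inequality strict. *)
  have e0 : 0 < eps / (2 * m) by apply: Rdiv_lt_0_compat; lra.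
  have [d hd] : locally x (fun y => ex_partial i F y /\ Rabs (partial i F y - partial i F x) < eps / (2 * m)).
    apply: filter_and; first exact: hex.
    exact: (hc i _ (locally_ball _ (mkposreal _ e0))).
  (* For [Rabs h < d / m] every coordinate moves by less than [d], so all intermediate points stay
     in the ball on which the estimate holds. *)
  have dm0 : 0 < d / m by apply: Rdiv_lt_0_compat => //; exact: cond_pos.
  exists (mkposreal _ dm0) => h h0 /= hlt.
  have -> : F (z i.+1 0) = F (z i 0).
    by rewrite z_succ [in RHS]z_upd; congr (F (upd _ _ _)); ring.
  have hm' : Rabs h * m < d.
    by move: hlt => /(Rmult_lt_compat_r m _ _ m0); rewrite /Rdiv Rmult_assoc Rinv_l; lra.
  have near_x r : Rmin (x i) (x i + h * v i) <= r <= Rmax (x i) (x i + h * v i) ->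
      ball (x : fct_UniformSpace _ _) d (upd (z i h) i r).
    move=> hr j; rewrite /ball /= /AbsRing_ball /= /abs /minus /plus /opp /= /upd.
    apply: Rle_lt_trans hm'; case: eqP => [->|_].
      apply: (Rle_trans _ (Rabs h * Rabs (v i))); last by apply: Rmult_le_compat_l (hm i); exact: Rabs_pos.
      by rewrite -Rabs_mult; move: hr; rewrite /Rmin /Rmax; case: Rle_dec => _ hr; split_Rabs; lra.
    apply: (Rle_trans _ (Rabs h * Rabs (v j))); last by apply: Rmult_le_compat_l (hm j); exact: Rabs_pos.
    rewrite -Rabs_mult /z; case: ifP => _; first by apply: Req_le; congr Rabs; ring.
    by rewrite (_ : _ + _ + _ = 0); [rewrite Rabs_R0; exact: Rabs_pos | ring].
  have B := @partial_increment _ F i (z i h) (x i) (x i + h * v i) (partial i F x) (eps / (2 * m)).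
  rewrite -z_succ -z_upd (_ : x i + h * v i - x i = h * v i) in B; last by ring.
  have {}B : Rabs (F (z i.+1 h) - F (z i h) - partial i F x * (h * v i)) <= eps / (2 * m) * Rabs (h * v i).
    by apply: B => r /near_x /hd [? ?]; split=> //; apply: Rlt_le.
  rewrite Rplus_0_l Rminus_diag Rminus_0_r.
  have -> : (F (z i.+1 h) - F (z i h)) / h - v i * partial i F x =
      (F (z i.+1 h) - F (z i h) - partial i F x * (h * v i)) * / h by field.
  have h1 : 0 < / Rabs h by apply: Rinv_0_lt_compat; exact: Rabs_pos_lt.
  rewrite Rabs_mult Rabs_inv.
  apply: (Rle_lt_trans _ (eps / (2 * m) * Rabs (h * v i) * / Rabs h)).
    by apply: Rmult_le_compat_r => //; lra.
  have -> : eps / (2 * m) * Rabs (h * v i) * / Rabs h = eps / (2 * m) * Rabs (v i).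
    by rewrite Rabs_mult; field; split; [lra | exact: Rabs_no_R0].
  apply: (Rle_lt_trans _ (eps / (2 * m) * m)); first by apply: Rmult_le_compat_l => //; lra.
  have -> : eps / (2 * m) * m = eps / 2 by field; lra.
  lra.
apply: (@is_derive_val _ (fun s => F x + \rsum_(i < n) (F (z i.+1 s) - F (z i s))) _ (0 + \rsum_(i < n) (v i * partial i F x))).
- move=> s.
  have -> : \rsum_(i < n) (F (z i.+1 s) - F (z i s)) = F (z n s) - F (z 0%N s).
    by rewrite -(big_mkord xpredT (fun i => F (z i.+1 s) - F (z i s))); exact: (GRing.telescope_sumr (fun i => F (z i s))).
  have -> : z 0%N s = x by apply: functional_extensionality => j; rewrite /z ltn0; ring.
  have -> : z n s = (fun j => x j + s * v j) by apply: functional_extensionality => j; rewrite /z ltn_ord.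
  ring.
- by apply: (is_derive_plus (fun=> F x)); [exact: is_derive_const | exact: is_derive_rsum].
- exact: Rplus_0_l.
Qed.

Lemma continuous_coord n (i : 'I_n) (x : 'I_n -> R) : continuous (fun y : 'I_n -> R => y i) x.
Proof.
move=> P [e he]; exists e => y hy; apply: he; exact: hy.
Qed.

Lemma dom_open a x : smooth_curve a -> dom a x -> locally x (dom a).
Proof.
move=> ha dx.
have c : continuous (lapse a) x.
  apply: (continuous_plus (fun=> 1)); first exact: continuous_const.
  apply: continuous_rsum => i.
  apply: (continuous_mult (fun y => space y i)); first exact: continuous_coord.
  apply: (continuous_comp (fun y => time y) (fun t => a t i)); first exact: continuous_coord.
  by apply: ex_derive_continuous; exact: (ha i 1%N _).
by apply: c; exact: open_gt dx.
Qed.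

(** [chain_rule_line] differentiates at parameter 0; other parameters are reached by taking
    [x + s v] as the base point. *)
Lemma line_derive a (F : ('I_4 -> R) -> R) x v s : smooth_curve a ->
  smooth_on (dom a) F -> dom a (fun j => x j + s * v j) ->
  is_derive (fun r => F (fun j => x j + r * v j)) s
    (\rsum_(al < 4) (v al * partial al F (fun j => x j + s * v j))).
Proof.
move=> ha hF dx; set p := (fun j => x j + s * v j) in dx *.
have h : is_derive (fun r => F (fun j => p j + r * v j)) 0 (\rsum_(al < 4) (v al * partial al F p)).
  apply: chain_rule_line => al; last exact: (hF [:: al] p dx).1.
  by apply: filter_imp (dom_open ha dx) => y dy; exact: (hF [::] y dy).2.
have g : is_derive (fun r => r - s) s 1 by auto_derive => //; ring.
have := @is_derive_comp R_AbsRing R_NormedModule (fun r => F (fun j => p j + r * v j)) (fun r => r - s) s.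
rewrite Rminus_diag => /(_ _ _ h g) k.
apply: (is_derive_val _ k); last by rewrite /scal /= /mult /= Rmult_1_l.
move=> r /=; congr F; apply: functional_extensionality => j; rewrite /p; ring.
Qed.

(* A map with [(Z xi - Z zeta) . (xi - zeta) = 0] and [Z 0 = 0] satisfies
   [Z xi . zeta = - Z zeta . xi]; with [zeta] on a coordinate axis this makes it linear. *)
Lemma rigid_affine (b : 'I_3 -> R) (Z : ('I_3 -> R) -> 'I_3 -> R) :
  (forall xi ze, 1 + dot xi b > 0 -> 1 + dot ze b > 0 ->
     dot (fun i => Z xi i - Z ze i) (fun i => xi i - ze i) = 0) ->
  exists c : 'I_3 -> 'I_3 -> R, (forall i j, c i j = - c j i) /\
    forall xi, 1 + dot xi b > 0 -> forall i, Z xi i = Z (fun=> 0) i + dot (c i) xi.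
Proof.
move=> h.
have h0 : 1 + dot (fun=> 0) b > 0 by rewrite dot0l; lra.
pose Z0 xi i := Z xi i - Z (fun=> 0) i.
have Z00 xi : 1 + dot xi b > 0 -> dot (Z0 xi) xi = 0.
  move=> hx; rewrite -[RHS](h _ _ hx h0); apply: eq_bigr => i _; rewrite /Z0; ring.
have anti xi ze : 1 + dot xi b > 0 -> 1 + dot ze b > 0 -> dot (Z0 xi) ze = - dot (Z0 ze) xi.
  move=> hx hz; have := h _ _ hx hz.
  have -> : dot (fun i => Z xi i - Z ze i) (fun i => xi i - ze i) =
      dot (Z0 xi) xi - dot (Z0 xi) ze - dot (Z0 ze) xi + dot (Z0 ze) ze.
    by rewrite /dot /Z0 !big_ord_recl !big_ord0 /=; ring.
  by rewrite !Z00 //; lra.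
have [e e0 he] := axis_step b.
(* From [anti] at the axis point, [e * Z0 xi i = - Z0 (axis i e) . xi]. The row [c i] is what this
   dictates after division by the step [e]. *)
exists (fun i j => - Z0 (axis i e) j / e); split=> [i j|xi hx i].
  have := anti _ _ (he i) (he j); rewrite !dot_axisr => k.
  have -> : Z0 (axis i e) j = - Z0 (axis j e) i by apply: (Rmult_eq_reg_l e); lra.
  by field; lra.
have := anti _ _ hx (he i); rewrite dot_axisr.
have -> : dot (fun j => - Z0 (axis i e) j / e) xi = - / e * dot (Z0 (axis i e)) xi.
  by rewrite -dotZl; apply: eq_bigr => j _; field; lra.
move: (dot _ _) => d k.
have : - / e * d = Z0 xi i by apply: (Rmult_eq_reg_l e); [field_simplify; lra | lra].
by rewrite /Z0; lra.
Qed.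

(** * Killing fields are affine *)

Lemma event_line xi w t s :
  (fun j => event xi t j + s * event w 0 j) = event (fun i => xi i + s * w i) t.
Proof.
by apply: functional_extensionality; apply: I4P => [|i]; rewrite ?event_tm ?event_sp //; ring.
Qed.

Lemma upd_event_tm xi t s : upd (event xi t) tm s = event xi s.
Proof. by rewrite -[LHS]eventE space_upd_tm time_upd_tm space_event. Qed.

Lemma upd_event_sp xi t i s : upd (event xi t) (sp i) s = event (upd xi i s) t.
Proof. by rewrite -[LHS]eventE space_upd_sp time_upd_sp space_event time_event. Qed.

Lemma dom_event a xi t : dom a (event xi t) = (1 + dot xi (a t) > 0).
Proof. by rewrite /dom space_event time_event. Qed.

Lemma dot_segment u v b s : dot (fun i => u i + s * (v i - u i)) b = (1 - s) * dot u b + s * dot v b.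
Proof. by rewrite -!dotZl -dotDl; apply: eq_bigr => i _; ring. Qed.

Lemma convex_gt0 p q s : 0 <= s <= 1 -> 1 + p > 0 -> 1 + q > 0 ->
  1 + ((1 - s) * p + s * q) > 0.
Proof.
move=> [s0 s1] hp hq; have -> : 1 + ((1 - s) * p + s * q) = (1 - s) * (1 + p) + s * (1 + q) by ring.
have [s0'|s0'] := Rle_lt_or_eq_dec _ _ s0; last by rewrite -s0'; lra.
have : 0 < s * (1 + q) by apply: Rmult_lt_0_compat; lra.
have : 0 <= (1 - s) * (1 + p) by apply: Rmult_le_pos; lra.
lra.
Qed.

Lemma spatial_derive a (F : ('I_4 -> R) -> R) xi w t s : smooth_curve a ->
  smooth_on (dom a) F -> dom a (event (fun i => xi i + s * w i) t) ->
  is_derive (fun r => F (event (fun i => xi i + r * w i) t)) s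
    (dot w (fun k => partial (sp k) F (event (fun i => xi i + s * w i) t))).
Proof.
move=> ha hF; rewrite -event_line => dx.
apply: (is_derive_val _ (line_derive ha hF dx)) => [r|]; first by rewrite event_line.
rewrite rsum_I4 event_tm Rmult_0_l Rplus_0_r.
by apply: eq_bigr => k _; rewrite event_sp.
Qed.

Section Affine.

Variables (a A : R -> 'I_3 -> R) (X : ('I_4 -> R) -> 'I_4 -> R).
Hypothesis ha : smooth_curve a.
Hypothesis hX : forall mu : 'I_4, smooth_on (dom a) (fun x => X x mu).
Hypothesis hK : generalised_killing a A X.

Lemma killing_rigid t xi ze : 1 + dot xi (a t) > 0 -> 1 + dot ze (a t) > 0 ->
  dot (fun i => X (event xi t) (sp i) - X (event ze t) (sp i)) (fun i => xi i - ze i) = 0.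
Proof.
move=> hx hz; pose w i := xi i - ze i.
pose phi s := dot w (fun i => X (event (fun i => ze i + s * w i) t) (sp i)).
have d s : 0 <= s <= 1 -> is_derive phi s zero.
  move=> hs.
  have dx : dom a (event (fun i => ze i + s * w i) t) by rewrite dom_event dot_segment; apply: convex_gt0.
  have [sk _ _] := (killing_split A ha X).1 hK _ dx.
  pose P i k := partial (sp k) (fun x => X x (sp i)) (event (fun i => ze i + s * w i) t).
  (* The derivative of [phi] is the quadratic form of the Jacobian [P] at [w], which is zero because
     the spatial equations make [P] skew. *)
  have e0 : dot w (fun i => dot (P i) w) = 0.
    have k : dot (fun i => dot (P i) w) w = - dot (fun i => dot (P i) w) w.
      by apply: dot_skew => i j; rewrite /P; have := sk i j; lra.
    by rewrite dotC; lra.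
  rewrite -[zero]e0; apply: is_derive_rsum_coef => i; rewrite dotC.
  exact: (spatial_derive ha (hX (sp i)) dx).
have e1 : (fun i => ze i + 1 * w i) = xi by apply: functional_extensionality => i; rewrite /w; ring.
have e0 : (fun i => ze i + 0 * w i) = ze by apply: functional_extensionality => i; rewrite /w; ring.
have : phi 0 = phi 1 by apply: eq_is_derive => //; lra.
rewrite /phi e0 e1 => e.
rewrite dotC -/w (_ : dot w _ = dot w (fun i => X (event xi t) (sp i)) + - dot w (fun i => X (event ze t) (sp i))).
  lra.
by rewrite -dotNl /dot -big_split; apply: eq_bigr => i _ /=; ring.
Qed.

(** The choice of [U] comes from [d_j (N X^4) = a_j X^4 + d_j X^4] at [xi = 0]. There [N = 1], and
    the mixed equation equates [d_j X^4] with the time derivative of [X^j], that is, of [F]. *)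
Let F t i := X (event (fun=> 0) t) (sp i).
Let y t := X (event (fun=> 0) t) tm.
Let O t i j := partial (sp j) (fun x => X x (sp i)) (event (fun=> 0) t).
Let U t j := a t j * y t + Derive (fun s => F s j) t.

Lemma dom_center t : dom a (event (fun=> 0) t).
Proof. by rewrite dom_event dot0l; lra. Qed.

(** The matrix [c] of [rigid_affine] is an existential witness for one time only. Differentiating
    the affine formula at [xi = 0] identifies it with [O t]. *)
Lemma killing_affine_sp x i : dom a x ->
  X x (sp i) = F (time x) i + dot (O (time x) i) (space x).
Proof.
move=> dx; set t := time x.
have [c [_ hc]] := rigid_affine (killing_rigid (t := t)).
have -> : O t i = c i.
  apply: functional_extensionality => k; apply: is_derive_unique.
  rewrite event_sp; apply: (is_derive_ext_loc (fun s => F t i + dot (c i) (upd (fun=> 0) k s))).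
    have := dom_line ha (sp k) (dom_center t); rewrite event_sp.
    apply: filter_imp => s; rewrite upd_event_sp dom_event => ds.
    by rewrite (hc _ ds).
  exact: (is_derive_dot_upd (F t i) (c i) (fun=> 0) k).
by rewrite -{1}(eventE x) hc //; move: dx; rewrite -{1}(eventE x) dom_event.
Qed.

Lemma F_derive t i : ex_derive (fun s => F s i) t.
Proof.
have := (hX (sp i) [::] (dom_center t)).2 tm; rewrite /ex_partial event_tm /=.
by apply: ex_derive_ext => s; rewrite upd_event_tm.
Qed.

Lemma y_derive t : ex_derive y t.
Proof.
have := (hX tm [::] (dom_center t)).2 tm; rewrite /ex_partial event_tm /=.
by apply: ex_derive_ext => s; rewrite upd_event_tm.
Qed.

Lemma O_derive t i j : ex_derive (fun s => O s i j) t.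
Proof.
have := (hX (sp i) [:: sp j] (dom_center t)).2 tm; rewrite /ex_partial event_tm /=.
by apply: ex_derive_ext => s; rewrite upd_event_tm.
Qed.

Lemma U_derive t i : ex_derive (fun s => U s i) t.
Proof.
apply: (ex_derive_plus (fun s => a s i * y s)).
  apply: (ex_derive_mult (fun s => a s i)); last exact: y_derive.
  exact: (ha i 1%N t).
have := (hX (sp i) [:: tm] (dom_center t)).2 tm; rewrite /ex_partial event_tm /=.
apply: ex_derive_ext => s; rewrite upd_event_tm /partial event_tm.
by apply: Derive_ext => r; rewrite upd_event_tm.
Qed.

Lemma O_skew t i j : O t i j = - O t j i.
Proof.
have [sk _ _] := (killing_split A ha X).1 hK _ (dom_center t).
by rewrite /O; have := sk i j; lra.
Qed.

Lemma killing_affine_tm x : dom a x ->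
  X x tm = (y (time x) + dot (U (time x)) (space x)) / lapse a x.
Proof.
move=> dx; set t := time x; set xi := space x.
pose c := dot xi (a t); pose q := dot xi (fun k => Derive (fun s => F s k) t).
have c0 : 1 + c > 0 by exact: dx.
have ray s : 0 <= s <= 1 -> 1 + s * c > 0.
  by move=> hs; have := @convex_gt0 0 c s hs; rewrite Rmult_0_r !Rplus_0_l; apply; lra.
(* The mixed equation makes the derivative of [X^4] along the ray equal to [q / (1 + s c)^2]; the
   subtracted quotient is its primitive vanishing at [s = 0]. *)
pose phi s := X (event (fun i => 0 + s * xi i) t) tm - q * s / (1 + s * c).
have d s : 0 <= s <= 1 -> is_derive phi s zero.
  move=> hs; have N0 := ray s hs.
  pose z := event (fun i => 0 + s * xi i) t.
  have lz : lapse a z = 1 + s * c.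
    rewrite /lapse /z space_event time_event /c -dotZl; congr (_ + _).
    by apply: eq_bigr => i _; ring.
  have dz : dom a z by rewrite /dom -/(lapse a z) lz.
  have -> : zero = minus (q / (1 + s * c) ^ 2) (q / (1 + s * c) ^ 2) :> R by rewrite minus_eq_zero.
  apply: (is_derive_minus (fun s => X (event (fun i => 0 + s * xi i) t) tm)); last first.
    by auto_derive; [lra | field; lra].
  have := spatial_derive ha (hX tm) dz; congr (is_derive _ _ _).
  have [_ k2 _] := (killing_split A ha X).1 hK _ dz.
  have e k : partial (sp k) (fun x0 => X x0 tm) z =
     / (1 + s * c) ^ 2 * (Derive (fun s => F s k) t + s * dot (fun j => Derive (fun s => O s k j) t) xi).
    have := k2 k; rewrite lz (partial_affine_tm_sp ha (fun t i => Derive_correct _ _ (F_derive t i))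
      (fun t i j => Derive_correct _ _ (O_derive t i j)) killing_affine_sp k dz).
    rewrite {1 2 3}/z time_event space_event.
    have -> : dot (fun j => Derive (fun s => O s k j) t) (fun i => 0 + s * xi i) =
        s * dot (fun j => Derive (fun s => O s k j) t) xi.
      by rewrite dotC [in RHS]dotC -dotZl; apply: eq_bigr => j _; ring.
    by move=> ->; field; lra.
  have -> : dot xi (fun k => partial (sp k) (fun x0 => X x0 tm) z) =
     / (1 + s * c) ^ 2 * (q + s * dot (fun k => dot (fun j => Derive (fun s => O s k j) t) xi) xi).
    rewrite /q [dot xi (fun k => Derive _ _)]dotC -dotZl -dotDl -dotZl dotC.
    by apply: eq_bigr => k _; rewrite e.
  (* Skewness of [O] at every time passes to its time derivative, so the quadratic term [D]
     vanishes. *)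
  have dO_skew k j : Derive (fun s => O s k j) t = - Derive (fun s => O s j k) t.
    by rewrite -Derive_opp; apply: Derive_ext => r; exact: O_skew.
  have := dot_skew xi xi dO_skew; move: (dot (fun k => dot _ xi) xi) => D hD.
  have -> : D = 0 by lra.
  by rewrite Rmult_0_r Rplus_0_r; exact: Rmult_comm.
have e1 : (fun i => 0 + 1 * xi i) = xi by apply: functional_extensionality => i; ring.
have e0 : (fun i => 0 + 0 * xi i) = (fun=> 0) by apply: functional_extensionality => i; ring.
have : phi 0 = phi 1 by apply: eq_is_derive => //; lra.
rewrite /phi e0 e1 /xi /t eventE -/t -/xi -/(y t) => e.
have -> : X x tm = y t + q / (1 + c) by move: e; rewrite !Rmult_1_l Rmult_1_r; lra.
(* Over the common denominator, [y + q / (1 + c)] has numerator [y + (c y + q)], which is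
   [y + U . xi]. *)
have -> : dot (U t) xi = c * y t + q.
  by rewrite /c /q Rmult_comm [dot xi _]dotC -dotZl [dot xi _]dotC -dotDl; apply: eq_bigr => i _; rewrite /U; ring.
rewrite /lapse -/t -/xi -/c; field; lra.
Qed.

Lemma killing_affine : exists F y O U, affine_field a X F y O U /\ killing_ode a A F y O U.
Proof.
have h : affine_field a X F y O U.
  move=> x dx; split=> [i|]; [exact: killing_affine_sp | exact: killing_affine_tm].
exists F, y, O, U; split=> //.
apply: ode_of_killing h _ _ _ _ hK => //.
- by move=> i t; exact: F_derive.
- exact: y_derive.
- by move=> i j t; exact: O_derive.
- by move=> i t; exact: U_derive.
Qed.

End Affine.

Theorem mainTheorem1
  (a A : R -> 'I_3 -> R) (X : ('I_4 -> R) -> 'I_4 -> R)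
  (L : R -> 'I_4 -> 'I_4 -> R)
  (ha : smooth_curve a) (hA : smooth_curve A)
  (hX : forall mu : 'I_4, smooth_on (dom a) (fun x => X x mu))
  (hL : is_Lambda a L) :
  generalised_killing a A X <->
  exists (f0 : 'I_4 -> R) (Om0 : 'I_4 -> 'I_4 -> R),
    (forall al be : 'I_4, Om0 al be = - Om0 be al) /\
    (forall x : 'I_4 -> R, dom a x ->
      (forall i : 'I_3,
         X x (sp i) =
           f_up L A f0 Om0 (sp i) (time x)
           + \rsum_(j < 3) (Omega_ud L A Om0 (time x) (sp i) (sp j) * x (sp j))) /\
      X x tm =
        (f_up L A f0 Om0 tm (time x)
         + \rsum_(j < 3) (Omega_ud L A Om0 (time x) tm (sp j) * x (sp j)))
        / (1 + dot (space x) (a (time x)))).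
Proof.
have A_cont k t : continuous (fun s => A s k) t.
  by apply: ex_derive_continuous; exact: (hA k 1%N t).
split=> [hK|[f0 [Om0 [sk h]]]]; last first.
  exact: killing_of_ode ha h (formula_ode hL A_cont f0 sk).
have [F [y [O [U [hF hO]]]]] := killing_affine ha hX hK.
have [f0 [Om0 [sk e]]] := ode_formula hL A_cont hO.
exists f0, Om0; split=> // x dx; have [h1 h2] := hF x dx; have [ef ey eO eU] := e (time x).
split=> [i|].
  by rewrite h1 ef; congr (_ + _); apply: eq_bigr => j _; rewrite eO.
by rewrite h2 ey; congr ((_ + _) / _); apply: eq_bigr => j _; rewrite eU.
Qed.
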